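(* Let $q\in\mathbb C^*$ satisfy $q^n\neq1$ for all integers $n\ge1$, and let $A_q=\mathbb C\langle x^{\pm1},y^{\pm1}\rangle/(xy-qyx)$. Under the identification $\mathrm{Aut}(A_q)\cong(\mathbb C^* )^2\rtimes\mathrm{SL}_2(\mathbb Z)$ described in the context, the canonical map $\Omega:\mathrm{Aut}(A_q)\to\mathrm{Pic}(A_q)$ induces an isomorphism of groups $$\mathrm{Pic}(A_q)\ \cong\ (\mathbb C^*/\mathbb Z)^2\rtimes \mathrm{SL}_2(\mathbb Z),$$ where $\mathbb Z$ is identified with the cyclic subgroup of $\mathbb C^*$ generated by $q$.
   Context: $\mathrm{Pic}(A_q)$ is the group of isomorphism classes of invertible $A_q$-bimodules that are symmetric over $\mathbb C$. The canonical group homomorphism $\Omega:\mathrm{Aut}(A_q)\to\mathrm{Pic}(A_q)$ takes $\sigma$ to the class of the bimodule $(A_q)^\sigma$, which is isomorphic to $A_q$ as a right module, with left action of $A_q$ twisted by $\sigma^{-1}$. $\mathrm{SL}_2(\mathbb Z)$ acts on $(\mathbb C^* )^2$ by $\begin{pmatrix}a&b\\c&d\end{pmatrix}:(\alpha,\beta)\mapsto(\alpha^a\beta^b,\alpha^c\beta^d)$, and the semidirect products are formed relative to this action. $\mathrm{SL}_2(\mathbb Z)$ has the presentation $\langle g_1,g_2\mid g_1g_2g_1=g_2g_1g_2,\ (g_1g_2)^6=1\rangle$ with $g_1=\begin{pmatrix}1&1\\0&1\end{pmatrix}$, $g_2=\begin{pmatrix}1&0\\-1&1\end{pmatrix}$.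 In the identification $(\mathbb C^* )^2\rtimes\mathrm{SL}_2(\mathbb Z)\cong\mathrm{Aut}(A_q)$, the element $(\alpha,\beta)\in(\mathbb C^* )^2$ corresponds to $(x,y)\mapsto(\alpha x,\beta y)$, $g_1$ corresponds to $(x,y)\mapsto(yx,y)$, and $g_2$ corresponds to $(x,y)\mapsto(x,yx^{-1})$; a general $g=\begin{pmatrix}a&b\\c&d\end{pmatrix}$ corresponds to an automorphism of the form $(x,y)\mapsto(\alpha_g\,y^bx^a,\ \beta_g\,y^dx^c)$ with constants $\alpha_g,\beta_g\in\mathbb C^*$. *)

(* Defs.v *)
From HB Require Import structures.
From mathcomp Require Import all_boot all_order all_algebra monoid.
From mathcomp Require Import boolp reals complex.

Set Implicit Arguments.
Unset Strict Implicit.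
Unset Printing Implicit Defensive.

Import GRing.Theory.
Local Open Scope ring_scope.

Section Quotient.
Variables (T : Type) (E : T -> T -> Prop).

Definition equiv_prop :=
  [/\ forall x, E x x, forall x y, E x y -> E y x
    & forall x y z, E x y -> E y z -> E x z].

Definition classes := {P : T -> Prop | exists x, P = E x}.

Definition cls (x : T) : classes := exist _ (E x) (ex_intro _ x erefl).
Definition rep (c : classes) : T := projT1 (cid (projT2 c)).

Lemma classes_inj (c d : classes) : sval c = sval d -> c = d.
Proof.
case: c d => [P p] [Q r] /= e; rewrite -{Q}e in r *.
by congr exist; exact: Prop_irrelevance.
Qed.

Lemma repK c : cls (rep c) = c.
Proof. by apply: classes_inj; rewrite /rep /=; case: cid. Qed.

Hypothesis equivE : equiv_prop.

Lemma cls_eqP x y : cls x = cls y <-> E x y.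
Proof.
have [Er Es Et] := equivE; split=> [/(congr1 sval) /= ->|Exy]; first exact: Er.
apply: classes_inj; apply: funext => z; apply: propext.
by split; apply: Et => //; exact: Es.
Qed.

Lemma rep_cls x : E (rep (cls x)) x.
Proof. by apply/cls_eqP; rewrite repK. Qed.

End Quotient.
Arguments cls {T} E x.

HB.instance Definition _ T (E : T -> T -> Prop) := gen_eqMixin (classes E).
HB.instance Definition _ T (E : T -> T -> Prop) := gen_choiceMixin (classes E).

(* Groups whose carrier may live in a universe above that of the library's    *)
(* structures: isomorphism classes of bimodules do not fit in a groupType.    *)
Record largeGroup := LargeGroup {
  lg_sort :> Type;
  lg_mul : lg_sort -> lg_sort -> lg_sort;
  lg_one : lg_sort;
  lg_inv : lg_sort -> lg_sort;
  lg_mulA : associative lg_mul;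
  lg_mul1 : left_id lg_one lg_mul;
  lg_mulr1 : right_id lg_one lg_mul;
  lg_mulV : left_inverse lg_one lg_inv lg_mul;
  lg_mulrV : right_inverse lg_one lg_inv lg_mul
}.

Section SemidirectProduct.
Variables (N H : groupType).
Local Open Scope group_scope.

Record autAction := AutAction {
  aact :> H -> N -> N;
  aact1 : forall n, aact 1 n = n;
  aactM : forall g h n, aact (g * h) n = aact g (aact h n);
  aact_morph : forall g n m, aact g (n * m) = aact g n * aact g m
}.

Lemma aact_1 (a : autAction) g : a g 1 = 1.
Proof. by apply: (@mulgI _ (a g 1)); rewrite -aact_morph !mulg1. Qed.

Record semidirect (a : autAction) := Semidirect { sd_n : N; sd_h : H }.

Variable a : autAction.

HB.instance Definition _ := gen_eqMixin (semidirect a).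
HB.instance Definition _ := gen_choiceMixin (semidirect a).

Definition sd_mul (u v : semidirect a) : semidirect a :=
  Semidirect a (sd_n u * a (sd_h u) (sd_n v)) (sd_h u * sd_h v).
Definition sd_one : semidirect a := Semidirect a 1 1.
Definition sd_inv (u : semidirect a) : semidirect a :=
  Semidirect a (a (sd_h u)^-1 (sd_n u)^-1) (sd_h u)^-1.

Lemma sd_mulA : associative sd_mul.
Proof.
by move=> u v w; rewrite /sd_mul /= aact_morph aactM !mulgA.
Qed.
Lemma sd_mul1 : left_id sd_one sd_mul.
Proof. by case=> n h; rewrite /sd_mul /= aact1 !mul1g. Qed.
Lemma sd_mulr1 : right_id sd_one sd_mul.
Proof. by case=> n h; rewrite /sd_mul /= aact_1 !mulg1. Qed.
Lemma sd_mulV : left_inverse sd_one sd_inv sd_mul.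
Proof. by case=> n h; rewrite /sd_mul /= -aact_morph !mulVg aact_1. Qed.
Lemma sd_mulrV : right_inverse sd_one sd_inv sd_mul.
Proof. by case=> n h; rewrite /sd_mul /= -aactM !mulgV aact1 mulgV. Qed.

HB.instance Definition _ := isGroup.Build (semidirect a)
  sd_mulA sd_mul1 sd_mulr1 sd_mulV sd_mulrV.

End SemidirectProduct.

Record SL2Z := SL2ZMx { sl2_mx :> 'M[int]_2; _ : \det sl2_mx == 1 }.

HB.instance Definition _ := [isSub for sl2_mx].
HB.instance Definition _ := [Choice of SL2Z by <:].

Lemma sl2_det (g : SL2Z) : \det g = 1. Proof. by case: g => M /= /eqP. Qed.

Fact sl2_mul_proof (g h : SL2Z) : \det (g *m h) == 1.
Proof. by rewrite det_mulmx !sl2_det. Qed.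
Fact sl2_one_proof : \det (1%:M : 'M[int]_2) == 1.
Proof. by rewrite det1. Qed.
Fact sl2_inv_proof (g : SL2Z) : \det (\adj g) == 1.
Proof.
have := congr1 determinant (mul_mx_adj g).
by rewrite det_mulmx sl2_det det1 mul1r => ->.
Qed.

Definition sl2_mul g h := SL2ZMx (sl2_mul_proof g h).
Definition sl2_one := SL2ZMx sl2_one_proof.
Definition sl2_inv g := SL2ZMx (sl2_inv_proof g).

Lemma sl2_mulA : associative sl2_mul.
Proof. by move=> f g h; apply: val_inj; rewrite /= mulmxA. Qed.
Lemma sl2_mul1 : left_id sl2_one sl2_mul.
Proof. by move=> f; apply: val_inj; rewrite /= mul1mx. Qed.
Lemma sl2_mulr1 : right_id sl2_one sl2_mul.
Proof. by move=> f; apply: val_inj; rewrite /= mulmx1. Qed.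
Lemma sl2_mulV : left_inverse sl2_one sl2_inv sl2_mul.
Proof. by move=> f; apply: val_inj; rewrite /= mul_adj_mx sl2_det. Qed.
Lemma sl2_mulrV : right_inverse sl2_one sl2_inv sl2_mul.
Proof. by move=> f; apply: val_inj; rewrite /= mul_mx_adj sl2_det. Qed.

HB.instance Definition _ :=
  isGroup.Build SL2Z sl2_mulA sl2_mul1 sl2_mulr1 sl2_mulV sl2_mulrV.

Definition mx2 (a b c d : int) : 'M[int]_2 :=
  \matrix_(i, j) (if i == 0 then (if j == 0 then a else b)
                  else (if j == 0 then c else d)).

Fact sl2_g1_proof : \det (mx2 1 1 0 1) == 1.
Proof. by rewrite (expand_det_row _ ord0) !big_ord_recl big_ord0 /cofactor !det_mx11 !mxE. Qed.
Fact sl2_g2_proof : \det (mx2 1 0 (-1) 1) == 1.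
Proof. by rewrite (expand_det_row _ ord0) !big_ord_recl big_ord0 /cofactor !det_mx11 !mxE. Qed.
Definition sl2_g1 := SL2ZMx sl2_g1_proof.
Definition sl2_g2 := SL2ZMx sl2_g2_proof.

Section TorusAction.
Variable U : groupType.
Local Open Scope group_scope.

Definition expgz (x : U) (n : int) : U :=
  match n with Posz m => x ^+ m | Negz m => x ^- m.+1 end.

Definition torus_act (g : SL2Z) (t : U * U) : U * U :=
  (expgz t.1 (sl2_mx g 0%R 0%R) * expgz t.2 (sl2_mx g 0%R 1%R),
   expgz t.1 (sl2_mx g 1%R 0%R) * expgz t.2 (sl2_mx g 1%R 1%R)).

Lemma expgzS x n : expgz x (n + 1)%R = expgz x n * x.
Proof.
case: n => n; first by rewrite -PoszD addn1 /= expgSr.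
case: n => [|n] /=; first by rewrite mulVg.
by rewrite subn1 /= [in RHS]expgS invgM mulgVK.
Qed.

Lemma expgzP x n : expgz x (n - 1)%R = expgz x n * x^-1.
Proof. by rewrite -[n in RHS](GRing.subrK 1%R) expgzS mulgK. Qed.

Lemma expgzD x n m : expgz x (n + m)%R = expgz x n * expgz x m.
Proof.
elim/int_rec: m => [|m IH|m IH]; first by rewrite addr0 mulg1.
- by rewrite -addn1 PoszD addrA !expgzS IH mulgA.
- by rewrite -addn1 PoszD opprD addrA !expgzP IH mulgA.
Qed.

Hypothesis UC : commutative (@mul U).

Lemma expgzMl x y n : expgz (x * y) n = expgz x n * expgz y n.
Proof.
case: n => n /=; rewrite expgMn //; try exact: UC.
by rewrite invgM UC.
Qed.

Lemma expgzV x n : expgz x (- n)%R = (expgz x n)^-1.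
Proof.
by apply: (@mulgI _ (expgz x n)); rewrite -expgzD subrr mulgV.
Qed.

Lemma expgzM x n m : expgz x (n * m)%R = expgz (expgz x m) n.
Proof.
elim/int_rec: n => [|n IH|n IH]; first by rewrite mul0r.
- by rewrite intS addrC mulrDl mul1r expgzD IH expgzS.
- by rewrite intS addrC opprD mulrBl mul1r expgzD expgzV IH expgzP.
Qed.

Fact torus_act1 t : torus_act 1 t = t.
Proof.
case: t => x y; rewrite /torus_act.
have E i j : sl2_mx 1 i j = (i == j)%:R by rewrite mxE.
by rewrite !E /= mulg1 mul1g.
Qed.

Fact torus_actM g h t : torus_act (g * h) t = torus_act g (torus_act h t).
Proof.
case: t => x y; rewrite /torus_act /=.
rewrite !mxE !big_ord_recl !big_ord0 /= !addr0.
have -> : lift ord0 ord0 = 1%R :> 'I_2 by apply: val_inj.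
by rewrite !expgzD !expgzMl !expgzM; congr pair; rewrite -!mulgA; congr mul;
  rewrite !mulgA; congr mul; rewrite UC.
Qed.

Fact torus_act_morph g s t :
  torus_act g (s * t) = torus_act g s * torus_act g t.
Proof.
case: s t => [x y] [x' y']; rewrite /torus_act /= !expgzMl.
by congr pair; rewrite -!mulgA; congr mul; rewrite !mulgA; congr mul; rewrite UC.
Qed.

Definition SL2Z_action : autAction (U * U)%type SL2Z :=
  AutAction torus_act1 torus_actM torus_act_morph.

End TorusAction.

Record Fstar (F : fieldType) := FStar { fs_val :> F; _ : fs_val != 0 }.
HB.instance Definition _ F := [isSub for @fs_val F].
HB.instance Definition _ F := [Choice of Fstar F by <:].

Section Fstar.
Variable F : fieldType.
Implicit Types x y z : Fstar F.

Lemma fs_neq0 x : fs_val x != 0. Proof. by case: x. Qed.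

Fact fs_mul_proof x y : fs_val x * fs_val y != 0.
Proof. by rewrite mulf_neq0 // fs_neq0. Qed.
Fact fs_inv_proof x : (fs_val x)^-1 != 0.
Proof. by rewrite invr_eq0 fs_neq0. Qed.
Definition fs_mul x y := FStar (fs_mul_proof x y).
Definition fs_one := FStar (oner_neq0 F).
Definition fs_inv x := FStar (fs_inv_proof x).

Lemma fs_mulA : associative fs_mul.
Proof. by move=> x y z; apply: val_inj; rewrite /= mulrA. Qed.
Lemma fs_mulC : commutative fs_mul.
Proof. by move=> x y; apply: val_inj; rewrite /= mulrC. Qed.
Lemma fs_mul1 : left_id fs_one fs_mul.
Proof. by move=> x; apply: val_inj; rewrite /= mul1r. Qed.
Lemma fs_mulr1 : right_id fs_one fs_mul.
Proof. by move=> x; apply: val_inj; rewrite /= mulr1. Qed.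
Lemma fs_mulV : left_inverse fs_one fs_inv fs_mul.
Proof. by move=> x; apply: val_inj; rewrite /= mulVf ?fs_neq0. Qed.
Lemma fs_mulrV : right_inverse fs_one fs_inv fs_mul.
Proof. by move=> x; apply: val_inj; rewrite /= mulfV ?fs_neq0. Qed.

HB.instance Definition _ := isGroup.Build (Fstar F)
  fs_mulA fs_mul1 fs_mulr1 fs_mulV fs_mulrV.

Lemma Fstar_mulC : commutative (@mul (Fstar F)). Proof. exact: fs_mulC. Qed.

End Fstar.

Section FstarModQ.
Variables (F : fieldType) (q : Fstar F).
Implicit Types x y z : Fstar F.
Local Open Scope group_scope.

Definition eq_mod_q x y := exists n : int, x = expgz q n * y.

Lemma eq_mod_q_equiv : equiv_prop eq_mod_q.
Proof.
split=> [x|x y [n ->]|x y z [n ->] [m ->]].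
- by exists 0%R; rewrite mul1g.
- by exists (- n)%R; rewrite expgzV mulKg.
- by exists (n + m)%R; rewrite expgzD mulgA.
Qed.

Definition FstarModQ := classes eq_mod_q.
HB.instance Definition _ := Choice.on FstarModQ.

Definition fsq_pi x : FstarModQ := cls eq_mod_q x.
Definition fsq_mul (a b : FstarModQ) := fsq_pi (rep a * rep b).
Definition fsq_inv (a : FstarModQ) := fsq_pi (rep a)^-1.

Lemma fsq_piP x y : fsq_pi x = fsq_pi y <-> eq_mod_q x y.
Proof. exact: (cls_eqP eq_mod_q_equiv). Qed.

Lemma fsq_pi_rep a : fsq_pi (rep a) = a. Proof. exact: repK. Qed.

Lemma fsq_piM x y : fsq_mul (fsq_pi x) (fsq_pi y) = fsq_pi (x * y).
Proof.
have [n en] := rep_cls eq_mod_q_equiv x.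
have [m em] := rep_cls eq_mod_q_equiv y.
apply/fsq_piP; exists (n + m)%R; rewrite en em expgzD -!mulgA; congr (_ * _).
by rewrite !mulgA [x * _]Fstar_mulC.
Qed.

Lemma fsq_piV x : fsq_inv (fsq_pi x) = fsq_pi x^-1.
Proof.
have [n en] := rep_cls eq_mod_q_equiv x.
by apply/fsq_piP; exists (- n)%R; rewrite en expgzV invgM Fstar_mulC.
Qed.

Lemma fsq_ind (P : FstarModQ -> Prop) :
  (forall x, P (fsq_pi x)) -> forall a, P a.
Proof. by move=> Pp a; rewrite -[a]fsq_pi_rep. Qed.

Lemma fsq_mulA : associative fsq_mul.
Proof.
elim/fsq_ind=> x; elim/fsq_ind=> y; elim/fsq_ind=> z.
by rewrite !fsq_piM mulgA.
Qed.
Lemma fsq_mulC : commutative fsq_mul.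
Proof.
by elim/fsq_ind=> x; elim/fsq_ind=> y; rewrite !fsq_piM Fstar_mulC.
Qed.
Lemma fsq_mul1 : left_id (fsq_pi 1) fsq_mul.
Proof. by elim/fsq_ind=> x; rewrite fsq_piM mul1g. Qed.
Lemma fsq_mulr1 : right_id (fsq_pi 1) fsq_mul.
Proof. by elim/fsq_ind=> x; rewrite fsq_piM mulg1. Qed.
Lemma fsq_mulV : left_inverse (fsq_pi 1) fsq_inv fsq_mul.
Proof. by elim/fsq_ind=> x; rewrite fsq_piV fsq_piM mulVg. Qed.
Lemma fsq_mulrV : right_inverse (fsq_pi 1) fsq_inv fsq_mul.
Proof. by elim/fsq_ind=> x; rewrite fsq_piV fsq_piM mulgV. Qed.

HB.instance Definition _ := isGroup.Build FstarModQ
  fsq_mulA fsq_mul1 fsq_mulr1 fsq_mulV fsq_mulrV.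

Lemma FstarModQ_mulC : commutative (@mul FstarModQ).
Proof. exact: fsq_mulC. Qed.

End FstarModQ.

(* F<x^{+-1}, y^{+-1}>/(xy - qyx): formal algebraic expressions modulo the    *)
(* congruence generated by the axioms of F-algebras and the given relations.  *)
Inductive qterm (F : Type) :=
| QX | QXinv | QY | QYinv
| QConst of F
| QAdd of qterm F & qterm F
| QMul of qterm F & qterm F.
Arguments QX {F}.
Arguments QXinv {F}.
Arguments QY {F}.
Arguments QYinv {F}.

Inductive qeq (F : fieldType) (q : F) : qterm F -> qterm F -> Prop :=
| qeq_refl t : qeq q t t
| qeq_sym s t : qeq q s t -> qeq q t s
| qeq_trans s t u : qeq q s t -> qeq q t u -> qeq q s u
| qeq_add s s' t t' :
    qeq q s s' -> qeq q t t' -> qeq q (QAdd s t) (QAdd s' t')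
| qeq_mul s s' t t' :
    qeq q s s' -> qeq q t t' -> qeq q (QMul s t) (QMul s' t')
| qeq_addA s t u : qeq q (QAdd s (QAdd t u)) (QAdd (QAdd s t) u)
| qeq_addC s t : qeq q (QAdd s t) (QAdd t s)
| qeq_add0 t : qeq q (QAdd (QConst 0) t) t
| qeq_addN t : qeq q (QAdd (QMul (QConst (-1)) t) t) (QConst 0)
| qeq_mulA s t u : qeq q (QMul s (QMul t u)) (QMul (QMul s t) u)
| qeq_mul1l t : qeq q (QMul (QConst 1) t) t
| qeq_mul1r t : qeq q (QMul t (QConst 1)) t
| qeq_mulDl s t u : qeq q (QMul (QAdd s t) u) (QAdd (QMul s u) (QMul t u))
| qeq_mulDr s t u : qeq q (QMul s (QAdd t u)) (QAdd (QMul s t) (QMul s u))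
| qeq_constD a b : qeq q (QConst (a + b)) (QAdd (QConst a) (QConst b))
| qeq_constM a b : qeq q (QConst (a * b)) (QMul (QConst a) (QConst b))
| qeq_constC a t : qeq q (QMul (QConst a) t) (QMul t (QConst a))
| qeq_xxV : qeq q (QMul QX QXinv) (QConst 1)
| qeq_xVx : qeq q (QMul QXinv QX) (QConst 1)
| qeq_yyV : qeq q (QMul QY QYinv) (QConst 1)
| qeq_yVy : qeq q (QMul QYinv QY) (QConst 1)
| qeq_xy : qeq q (QMul QX QY) (QMul (QConst q) (QMul QY QX)).

Definition qtorus (F : fieldType) (q : Fstar F) := classes (qeq (fs_val q)).
HB.instance Definition _ F q := Choice.on (@qtorus F q).

Section QuantumTorus.
Variables (F : fieldType) (q : Fstar F).
Implicit Types (s t u : qterm F) (a b c : qtorus q).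

Lemma qeq_equiv : equiv_prop (qeq (fs_val q)).
Proof.
split; [exact: qeq_refl | exact: qeq_sym | exact: qeq_trans].
Qed.

Definition qt_pi t : qtorus q := cls (qeq (fs_val q)) t.
Lemma qt_piP s t : qt_pi s = qt_pi t <-> qeq (fs_val q) s t.
Proof. exact: (cls_eqP qeq_equiv). Qed.

Definition qt_add a b := qt_pi (QAdd (rep a) (rep b)).
Definition qt_mul a b := qt_pi (QMul (rep a) (rep b)).
Definition qt_const (k : F) := qt_pi (QConst k).
Definition qt_scale k a := qt_mul (qt_const k) a.
Definition qt_opp a := qt_scale (-1) a.

Lemma qt_piD s t : qt_add (qt_pi s) (qt_pi t) = qt_pi (QAdd s t).
Proof. by apply/qt_piP/qeq_add; apply: rep_cls; exact: qeq_equiv. Qed.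
Lemma qt_piM s t : qt_mul (qt_pi s) (qt_pi t) = qt_pi (QMul s t).
Proof. by apply/qt_piP/qeq_mul; apply: rep_cls; exact: qeq_equiv. Qed.

Lemma qt_ind (P : qtorus q -> Prop) : (forall t, P (qt_pi t)) -> forall a, P a.
Proof. by move=> Pp a; rewrite -[a]repK. Qed.

Lemma qt_addA : associative qt_add.
Proof.
elim/qt_ind=> s; elim/qt_ind=> t; elim/qt_ind=> u.
by rewrite !qt_piD; apply/qt_piP/qeq_addA.
Qed.
Lemma qt_addC : commutative qt_add.
Proof.
by elim/qt_ind=> s; elim/qt_ind=> t; rewrite !qt_piD; apply/qt_piP/qeq_addC.
Qed.
Lemma qt_add0 : left_id (qt_const 0) qt_add.
Proof. by elim/qt_ind=> s; rewrite qt_piD; apply/qt_piP/qeq_add0. Qed.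
Lemma qt_addN : left_inverse (qt_const 0) qt_opp qt_add.
Proof. by elim/qt_ind=> s; rewrite /qt_opp /qt_scale qt_piM qt_piD; apply/qt_piP/qeq_addN. Qed.

HB.instance Definition _ :=
  GRing.isZmodule.Build (qtorus q) qt_addA qt_addC qt_add0 qt_addN.

Lemma qt_mulA : associative qt_mul.
Proof.
elim/qt_ind=> s; elim/qt_ind=> t; elim/qt_ind=> u.
by rewrite !qt_piM; apply/qt_piP/qeq_mulA.
Qed.
Lemma qt_mul1 : left_id (qt_const 1) qt_mul.
Proof. by elim/qt_ind=> s; rewrite qt_piM; apply/qt_piP/qeq_mul1l. Qed.
Lemma qt_mulr1 : right_id (qt_const 1) qt_mul.
Proof. by elim/qt_ind=> s; rewrite qt_piM; apply/qt_piP/qeq_mul1r. Qed.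
Lemma qt_mulDl : left_distributive qt_mul qt_add.
Proof.
elim/qt_ind=> s; elim/qt_ind=> t; elim/qt_ind=> u.
by rewrite !(qt_piM, qt_piD); apply/qt_piP/qeq_mulDl.
Qed.
Lemma qt_mulDr : right_distributive qt_mul qt_add.
Proof.
elim/qt_ind=> s; elim/qt_ind=> t; elim/qt_ind=> u.
by rewrite !(qt_piM, qt_piD); apply/qt_piP/qeq_mulDr.
Qed.

(* Action on functions on Z by (x f)(n) = q^n f(n), (y f)(n) = f(n - 1),      *)
(* which shows that the algebra is not zero.                                  *)
Fixpoint qt_eval t (f : int -> F) : int -> F :=
  match t with
  | QX => fun n => fs_val q ^ n * f n
  | QXinv => fun n => fs_val q ^ (- n) * f n
  | QY => fun n => f (n - 1)
  | QYinv => fun n => f (n + 1)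
  | QConst k => fun n => k * f n
  | QAdd s t => fun n => qt_eval s f n + qt_eval t f n
  | QMul s t => qt_eval s (qt_eval t f)
  end.

Lemma qt_eval_ext t f g : f =1 g -> qt_eval t f =1 qt_eval t g.
Proof.
elim: t f g => [||||k|s IHs t IHt|s IHs t IHt] f g efg n //=; rewrite ?efg //.
  by rewrite (IHs _ _ efg) (IHt _ _ efg).
by apply: IHs; exact: IHt.
Qed.

Lemma qt_evalD t f g n :
  qt_eval t (fun m => f m + g m) n = qt_eval t f n + qt_eval t g n.
Proof.
elim: t f g n => [||||k|s IHs t IHt|s IHs t IHt] f g n //=; rewrite ?mulrDr //.
  by rewrite IHs IHt addrACA.
by rewrite -IHs; apply: qt_eval_ext.
Qed.

Lemma qt_evalZ t k f n : qt_eval t (fun m => k * f m) n = k * qt_eval t f n.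
Proof.
elim: t f n => [||||l|s IHs t IHt|s IHs t IHt] f n //=; rewrite 1?mulrCA //.
  by rewrite IHs IHt mulrDr.
by rewrite -IHs; apply: qt_eval_ext.
Qed.

Lemma qt_evalP s t : qeq (fs_val q) s t -> forall f, qt_eval s f =1 qt_eval t f.
Proof.
have q0 := fs_neq0 q.
have qNq n : fs_val q ^ n * fs_val q ^ (- n) = 1.
  by rewrite -expfzDr // subrr expr0z.
elim=> {s t} /=.
- by [].
- by move=> s t _ IH f n; rewrite IH.
- by move=> s t u _ IH1 _ IH2 f n; rewrite IH1 IH2.
- by move=> s s' t t' _ IH1 _ IH2 f n; rewrite IH1 IH2.
- move=> s s' t t' _ IH1 _ IH2 f n; rewrite IH1; exact: qt_eval_ext.
- by move=> s t u f n; rewrite addrA.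
- by move=> s t f n; rewrite addrC.
- by move=> t f n; rewrite mul0r add0r.
- by move=> t f n; rewrite mulN1r addNr mul0r.
- by [].
- by move=> t f n; rewrite mul1r.
- by move=> t f n; apply: qt_eval_ext => m; rewrite mul1r.
- by [].
- by move=> s t u f n; rewrite qt_evalD.
- by move=> a b f n; rewrite mulrDl.
- by move=> a b f n; rewrite mulrA.
- by move=> a t f n; rewrite qt_evalZ.
- by move=> f n; rewrite mulrA qNq mul1r.
- by move=> f n; rewrite mulrA [fs_val q ^ (- n) * _]mulrC qNq mul1r.
- by move=> f n; rewrite subrK mul1r.
- by move=> f n; rewrite addrK mul1r.
- move=> f n; rewrite [RHS]mulrA; congr (_ * _).
  by rewrite -[X in _ = X * _]expr1z -expfzDr // addrC subrK.
Qed.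

Lemma qt_1_neq0 : qt_const 1 != 0.
Proof.
apply/eqP => /qt_piP /qt_evalP /(_ (fun=> 1) 0) /= /eqP.
by rewrite !mul1r mul0r oner_eq0.
Qed.

HB.instance Definition _ := GRing.Zmodule_isNzRing.Build (qtorus q)
  qt_mulA qt_mul1 qt_mulr1 qt_mulDl qt_mulDr qt_1_neq0.

Lemma qt_constD k l : qt_const (k + l) = qt_const k + qt_const l.
Proof. by rewrite [RHS]qt_piD; apply/qt_piP/qeq_constD. Qed.
Lemma qt_constM k l : qt_const (k * l) = qt_const k * qt_const l.
Proof. by rewrite [RHS]qt_piM; apply/qt_piP/qeq_constM. Qed.
Lemma qt_constC k a : qt_const k * a = a * qt_const k.
Proof.
by elim/qt_ind: a => t; rewrite [LHS]qt_piM [RHS]qt_piM; apply/qt_piP/qeq_constC.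
Qed.

Lemma qt_scaleA k l a : qt_scale k (qt_scale l a) = qt_scale (k * l) a.
Proof. by rewrite /qt_scale qt_constM; apply: mulrA. Qed.
Lemma qt_scale1 : left_id 1 qt_scale.
Proof. exact: (@mul1r (qtorus q)). Qed.
Lemma qt_scaleDr : right_distributive qt_scale +%R.
Proof. by move=> k a b; apply: mulrDr. Qed.
Lemma qt_scaleDl a : {morph qt_scale^~ a : k l / k + l}.
Proof. by move=> k l; rewrite /qt_scale qt_constD; apply: mulrDl. Qed.

HB.instance Definition _ := GRing.Zmodule_isLmodule.Build F (qtorus q)
  qt_scaleA qt_scale1 qt_scaleDr qt_scaleDl.

Lemma qt_scaleAl k a b : k *: (a * b) = (k *: a) * b.
Proof. exact: (@mulrA (qtorus q)). Qed.
HB.instance Definition _ :=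
  GRing.Lmodule_isLalgebra.Build F (qtorus q) qt_scaleAl.

Lemma qt_scaleAr k a b : k *: (a * b) = a * (k *: b).
Proof.
change (qt_const k * (a * b) = a * (qt_const k * b)).
by rewrite mulrA qt_constC -mulrA.
Qed.
HB.instance Definition _ :=
  GRing.Lalgebra_isAlgebra.Build F (qtorus q) qt_scaleAr.

Definition qx : qtorus q := qt_pi QX.
Definition qxV : qtorus q := qt_pi QXinv.
Definition qy : qtorus q := qt_pi QY.
Definition qyV : qtorus q := qt_pi QYinv.

Definition qx_pow (n : int) : qtorus q :=
  match n with Posz m => qx ^+ m | Negz m => qxV ^+ m.+1 end.
Definition qy_pow (n : int) : qtorus q :=
  match n with Posz m => qy ^+ m | Negz m => qyV ^+ m.+1 end.

End QuantumTorus.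

Section AlgebraAutomorphisms.
Variables (F : fieldType) (A : algType F).

Record algAut := AlgAut {
  aut_fun :> A -> A;
  aut_inv : A -> A;
  aut_linear : linear aut_fun;
  aut_monoid : monoid_morphism aut_fun;
  autK : cancel aut_fun aut_inv;
  autVK : cancel aut_inv aut_fun
}.

HB.instance Definition _ := gen_eqMixin algAut.
HB.instance Definition _ := gen_choiceMixin algAut.

Lemma algAut_inj (s t : algAut) : aut_fun s =1 aut_fun t -> s = t.
Proof.
case: s t => [f f' lf mf fK f'K] [g g' lg mg gK g'K] /= /funext efg.
subst g.
have e' : f' = g' by apply: funext => x; rewrite -{1}[x]g'K fK.
subst g'; congr AlgAut; exact: Prop_irrelevance.
Qed.

Lemma aut_inv_linear (s : algAut) : linear (aut_inv s).
Proof.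
move=> k u v; apply: (can_inj (autK s)).
by rewrite aut_linear !autVK.
Qed.

Lemma aut_inv_monoid (s : algAut) : monoid_morphism (aut_inv s).
Proof.
have [s1 sM] := aut_monoid s.
split=> [|u v]; apply: (can_inj (autK s)); first by rewrite autVK s1.
by rewrite sM !autVK.
Qed.

Fact aut_comp_linear (s t : algAut) : linear (t \o s).
Proof. by move=> k u v /=; rewrite !aut_linear. Qed.
Fact aut_comp_monoid (s t : algAut) : monoid_morphism (t \o s).
Proof.
have [s1 sM] := aut_monoid s; have [t1 tM] := aut_monoid t.
by split=> [|u v] /=; rewrite ?s1 ?t1 // sM tM.
Qed.

(* Automorphisms are multiplied as substitutions of the generators: s * t is  *)
(* the composite t \o s, so that for s : (x, y) |-> (f(x, y), g(x, y)) the    *)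
(* product s * t evaluates f and g at the pair given by t. This is the order  *)
(* for which (a b; c d) |-> ((x, y) |-> (y^b x^a, y^d x^c)) is multiplicative *)
(* up to scalars.                                                             *)
Definition aut_mul (s t : algAut) : algAut :=
  AlgAut (aut_comp_linear s t) (aut_comp_monoid s t)
    (can_comp (autK t) (autK s)) (can_comp (autVK s) (autVK t)).

Definition aut_one : algAut :=
  @AlgAut idfun idfun (fun _ _ _ => erefl) (erefl, fun _ _ => erefl)
    (fun=> erefl) (fun=> erefl).

Definition aut_inverse (s : algAut) : algAut :=
  AlgAut (aut_inv_linear s) (aut_inv_monoid s) (autVK s) (autK s).

Lemma aut_mulA : associative aut_mul.
Proof. by move=> s t u; apply: algAut_inj. Qed.
Lemma aut_mul1 : left_id aut_one aut_mul.
Proof. by move=> s; apply: algAut_inj. Qed.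
Lemma aut_mulr1 : right_id aut_one aut_mul.
Proof. by move=> s; apply: algAut_inj. Qed.
Lemma aut_mulV : left_inverse aut_one aut_inverse aut_mul.
Proof. by move=> s; apply: algAut_inj => x /=; rewrite autVK. Qed.
Lemma aut_mulrV : right_inverse aut_one aut_inverse aut_mul.
Proof. by move=> s; apply: algAut_inj => x /=; rewrite autK. Qed.

HB.instance Definition _ := isGroup.Build algAut
  aut_mulA aut_mul1 aut_mulr1 aut_mulV aut_mulrV.

End AlgebraAutomorphisms.

Record bimodule (A : nzRingType) := Bimodule {
  bm_sort :> zmodType;
  lact : A -> bm_sort -> bm_sort;
  ract : bm_sort -> A -> bm_sort;
  lactDl : forall m, {morph lact^~ m : a b / a + b};
  lactDr : forall a, {morph lact a : m n / m + n};
  lact1 : forall m, lact 1 m = m;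
  lactM : forall a b m, lact (a * b) m = lact a (lact b m);
  ractDl : forall a, {morph ract^~ a : m n / m + n};
  ractDr : forall m, {morph ract m : a b / a + b};
  ract1 : forall m, ract m 1 = m;
  ractM : forall m a b, ract m (a * b) = ract (ract m a) b;
  lractA : forall a m b, lact a (ract m b) = ract (lact a m) b
}.

Section Bimodules.
Variable A : nzRingType.
Implicit Types M N P : bimodule A.

Definition bm_hom M N (f : M -> N) :=
  [/\ {morph f : m n / m + n},
      forall a m, f (lact a m) = lact a (f m)
    & forall m a, f (ract m a) = ract (f m) a].

Definition bm_iso M N := exists f : M -> N, bm_hom f /\ bijective f.

Lemma bm_iso_refl M : bm_iso M M.
Proof. by exists idfun; split; [split | exists idfun]. Qed.

Lemma bm_hom_inv M N (f : M -> N) (g : N -> M) :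
  bm_hom f -> cancel f g -> cancel g f -> bm_hom g.
Proof.
move=> [fD fl fr] fK gK; split=> [m n|a m|m a]; apply: (can_inj fK).
- by rewrite fD !gK.
- by rewrite fl !gK.
- by rewrite fr !gK.
Qed.

Lemma bm_iso_sym M N : bm_iso M N -> bm_iso N M.
Proof.
case=> f [hf [g fK gK]]; exists g; split; last by exists f.
exact: bm_hom_inv hf fK gK.
Qed.

Lemma bm_iso_trans M N P : bm_iso M N -> bm_iso N P -> bm_iso M P.
Proof.
case=> f [[fD fl fr] fB] [g [[gD gl gr] gB]].
exists (g \o f); split; last exact: bij_comp.
split=> [m n|a m|m a] /=; first by rewrite fD gD.
  by rewrite fl gl.
by rewrite fr gr.
Qed.

Definition regular_bm : bimodule A :=
  @Bimodule A A *%R *%R (fun m a b => mulrDl a b m) (@mulrDr A) (@mul1r A)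
    (fun a b m => esym (mulrA a b m)) (fun a m n => mulrDl m n a) (@mulrDr A)
    (@mulr1 A) (@mulrA A) (@mulrA A).

End Bimodules.

(* M (x)_A N: formal sums of symbols m (x) n modulo the congruence generated  *)
(* by the axioms of abelian groups, biadditivity and A-balancedness.          *)
Inductive tterm (M N : Type) :=
| TPure of M & N
| TZero
| TAdd of tterm M N & tterm M N
| TOpp of tterm M N.
Arguments TZero {M N}.

Inductive teq (A : nzRingType) (M N : bimodule A) :
    tterm M N -> tterm M N -> Prop :=
| teq_refl t : teq t t
| teq_sym s t : teq s t -> teq t s
| teq_trans s t u : teq s t -> teq t u -> teq s u
| teq_add s s' t t' : teq s s' -> teq t t' -> teq (TAdd s t) (TAdd s' t')
| teq_opp s t : teq s t -> teq (TOpp s) (TOpp t)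
| teq_addA s t u : teq (TAdd s (TAdd t u)) (TAdd (TAdd s t) u)
| teq_addC s t : teq (TAdd s t) (TAdd t s)
| teq_add0 t : teq (TAdd TZero t) t
| teq_addN t : teq (TAdd (TOpp t) t) TZero
| teq_pureDl m m' n :
    teq (TPure (m + m') n) (TAdd (TPure m n) (TPure m' n))
| teq_pureDr m n n' :
    teq (TPure m (n + n')) (TAdd (TPure m n) (TPure m n'))
| teq_balanced m a n : teq (TPure (ract m a) n) (TPure m (lact a n)).

Definition tensor_sort (A : nzRingType) (M N : bimodule A) :=
  classes (@teq A M N).
HB.instance Definition _ A M N := Choice.on (@tensor_sort A M N).

Section Tensor.
Variables (A : nzRingType) (M N : bimodule A).
Implicit Types (s t u : tterm M N) (x y z : tensor_sort M N).

Lemma teq_equiv : equiv_prop (@teq A M N).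
Proof. split; [exact: teq_refl | exact: teq_sym | exact: teq_trans]. Qed.

Definition tn_pi t : tensor_sort M N := cls (@teq A M N) t.
Lemma tn_piP s t : tn_pi s = tn_pi t <-> teq s t.
Proof. exact: (cls_eqP teq_equiv). Qed.

Lemma tn_ind (P : tensor_sort M N -> Prop) :
  (forall t, P (tn_pi t)) -> forall x, P x.
Proof. by move=> Pp x; rewrite -[x]repK. Qed.

Definition tn_add x y := tn_pi (TAdd (rep x) (rep y)).
Definition tn_opp x := tn_pi (TOpp (rep x)).

Lemma tn_piD s t : tn_add (tn_pi s) (tn_pi t) = tn_pi (TAdd s t).
Proof. by apply/tn_piP/teq_add; apply: rep_cls; exact: teq_equiv. Qed.
Lemma tn_piN s : tn_opp (tn_pi s) = tn_pi (TOpp s).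
Proof. by apply/tn_piP/teq_opp; apply: rep_cls; exact: teq_equiv. Qed.

Lemma tn_addA : associative tn_add.
Proof.
elim/tn_ind=> s; elim/tn_ind=> t; elim/tn_ind=> u.
by rewrite !tn_piD; apply/tn_piP/teq_addA.
Qed.
Lemma tn_addC : commutative tn_add.
Proof.
by elim/tn_ind=> s; elim/tn_ind=> t; rewrite !tn_piD; apply/tn_piP/teq_addC.
Qed.
Lemma tn_add0 : left_id (tn_pi TZero) tn_add.
Proof. by elim/tn_ind=> s; rewrite tn_piD; apply/tn_piP/teq_add0. Qed.
Lemma tn_addN : left_inverse (tn_pi TZero) tn_opp tn_add.
Proof. by elim/tn_ind=> s; rewrite tn_piN tn_piD; apply/tn_piP/teq_addN. Qed.

HB.instance Definition _ :=
  GRing.isZmodule.Build (tensor_sort M N) tn_addA tn_addC tn_add0 tn_addN.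

Definition pure (m : M) (n : N) : tensor_sort M N := tn_pi (TPure m n).

Lemma pureDl m m' n : pure (m + m') n = pure m n + pure m' n.
Proof. by rewrite [RHS]tn_piD; apply/tn_piP/teq_pureDl. Qed.
Lemma pureDr m n n' : pure m (n + n') = pure m n + pure m n'.
Proof. by rewrite [RHS]tn_piD; apply/tn_piP/teq_pureDr. Qed.
Lemma pure_balanced m a n : pure (ract m a) n = pure m (lact a n).
Proof. exact/tn_piP/teq_balanced. Qed.

Definition balanced (V : zmodType) (f : M -> N -> V) :=
  [/\ forall n, {morph f^~ n : m m' / m + m'},
      forall m, {morph f m : n n' / n + n'}
    & forall m a n, f (ract m a) n = f m (lact a n)].

Fixpoint tlift_term (V : zmodType) (f : M -> N -> V) t : V :=
  match t with
  | TPure m n => f m n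
  | TZero => 0
  | TAdd s t => tlift_term f s + tlift_term f t
  | TOpp s => - tlift_term f s
  end.

Definition tlift (V : zmodType) (f : M -> N -> V) x := tlift_term f (rep x).

Lemma tlift_termP (V : zmodType) (f : M -> N -> V) s t :
  balanced f -> teq s t -> tlift_term f s = tlift_term f t.
Proof.
case=> fDl fDr fb; elim=> {s t} /=.
- by [].
- by move=> s t _ ->.
- by move=> s t u _ -> _ ->.
- by move=> s s' t t' _ -> _ ->.
- by move=> s t _ ->.
- by move=> s t u; rewrite addrA.
- by move=> s t; rewrite addrC.
- by move=> t; rewrite add0r.
- by move=> t; rewrite addNr.
- by move=> m m' n; exact: fDl.
- by move=> m n n'; exact: fDr.
- by move=> m a n; exact: fb.
Qed.

Lemma tlift_pi (V : zmodType) (f : M -> N -> V) t :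
  balanced f -> tlift f (tn_pi t) = tlift_term f t.
Proof.
by move=> fb; apply: tlift_termP fb _; apply: rep_cls; exact: teq_equiv.
Qed.

Lemma tlift_pure (V : zmodType) (f : M -> N -> V) m n :
  balanced f -> tlift f (pure m n) = f m n.
Proof. by move=> fb; rewrite tlift_pi. Qed.

Lemma tliftD (V : zmodType) (f : M -> N -> V) :
  balanced f -> {morph tlift f : x y / x + y}.
Proof.
move=> fb; elim/tn_ind=> s; elim/tn_ind=> t.
by rewrite [tn_pi s + _]tn_piD !tlift_pi.
Qed.

Lemma morphD0 (U V : zmodType) (f : U -> V) :
  {morph f : x y / x + y} -> f 0 = 0.
Proof. by move=> fD; apply: (addrI (f 0)); rewrite -fD !addr0. Qed.

Lemma morphDN (U V : zmodType) (f : U -> V) :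
  {morph f : x y / x + y} -> {morph f : x / - x}.
Proof.
by move=> fD x; apply: (addrI (f x)); rewrite -fD !subrr (morphD0 fD).
Qed.

Lemma tensor_ext (V : zmodType) (f g : tensor_sort M N -> V) :
    {morph f : x y / x + y} -> {morph g : x y / x + y} ->
  (forall m n, f (pure m n) = g (pure m n)) -> f =1 g.
Proof.
move=> fD gD efg; elim/tn_ind; elim=> [m n||s IHs t IHt|s IHs].
- exact: efg.
- by rewrite (morphD0 fD) (morphD0 gD).
- by rewrite -tn_piD [f _]fD [g _]gD IHs IHt.
- by rewrite -tn_piN [f _](morphDN fD) [g _](morphDN gD) IHs.
Qed.

Definition tn_lact (a : A) := tlift (fun m n => pure (lact a m) n).
Definition tn_ract x (a : A) := tlift (fun m n => pure m (ract n a)) x.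

Lemma tn_lact_balanced a : balanced (fun m n => pure (lact a m) n).
Proof.
split=> [n m m'|m n n'|m b n]; first by rewrite lactDr pureDl.
  by rewrite pureDr.
by rewrite lractA pure_balanced.
Qed.
Lemma tn_ract_balanced a : balanced (fun m n => pure m (ract n a)).
Proof.
split=> [n m m'|m n n'|m b n]; first by rewrite pureDl.
  by rewrite ractDl pureDr.
by rewrite pure_balanced lractA.
Qed.

Lemma tn_lact_pure a m n : tn_lact a (pure m n) = pure (lact a m) n.
Proof. exact/tlift_pure/tn_lact_balanced. Qed.
Lemma tn_ract_pure a m n : tn_ract (pure m n) a = pure m (ract n a).
Proof. exact/(tlift_pure m n)/tn_ract_balanced. Qed.
Lemma tn_lactDr a : {morph tn_lact a : x y / x + y}.
Proof. exact/tliftD/tn_lact_balanced. Qed.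
Lemma tn_ractDl a : {morph tn_ract^~ a : x y / x + y}.
Proof. exact/(tliftD (tn_ract_balanced a)). Qed.

Lemma tn_lactDl x : {morph tn_lact^~ x : a b / a + b}.
Proof.
move=> a b; move: x; apply: tensor_ext; first exact: tn_lactDr.
  by move=> x y; rewrite !tn_lactDr addrACA.
by move=> m n; rewrite !tn_lact_pure lactDl pureDl.
Qed.
Lemma tn_lact1 x : tn_lact 1 x = x.
Proof.
move: x; apply: tensor_ext => //; first exact: tn_lactDr.
by move=> m n; rewrite tn_lact_pure lact1.
Qed.
Lemma tn_lactM a b x : tn_lact (a * b) x = tn_lact a (tn_lact b x).
Proof.
move: x; apply: tensor_ext; first exact: tn_lactDr.
  by move=> x y; rewrite !tn_lactDr.
by move=> m n; rewrite !tn_lact_pure lactM.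
Qed.
Lemma tn_ractDr x : {morph tn_ract x : a b / a + b}.
Proof.
move=> a b; move: x; apply: tensor_ext; first exact: tn_ractDl.
  by move=> x y; rewrite !tn_ractDl addrACA.
by move=> m n; rewrite !tn_ract_pure ractDr pureDr.
Qed.
Lemma tn_ract1 x : tn_ract x 1 = x.
Proof.
move: x; apply: tensor_ext => //; first exact: tn_ractDl.
by move=> m n; rewrite tn_ract_pure ract1.
Qed.
Lemma tn_ractM x a b : tn_ract x (a * b) = tn_ract (tn_ract x a) b.
Proof.
move: x; apply: tensor_ext; first exact: tn_ractDl.
  by move=> x y; rewrite !tn_ractDl.
by move=> m n; rewrite !tn_ract_pure ractM.
Qed.
Lemma tn_lractA a x b : tn_lact a (tn_ract x b) = tn_ract (tn_lact a x) b.
Proof.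
move: x; apply: tensor_ext.
- by move=> x y; rewrite tn_ractDl tn_lactDr.
- by move=> x y; rewrite tn_lactDr tn_ractDl.
by move=> m n; rewrite !(tn_ract_pure, tn_lact_pure).
Qed.

Definition tensor : bimodule A :=
  Bimodule tn_lactDl tn_lactDr tn_lact1 tn_lactM
    tn_ractDl tn_ractDr tn_ract1 tn_ractM tn_lractA.

End Tensor.

Section TensorIso.
Variable A : nzRingType.
Implicit Types M N P : bimodule A.

Lemma bm_iso_can M N (f : M -> N) (g : N -> M) :
  bm_hom f -> cancel f g -> cancel g f -> bm_iso M N.
Proof. by move=> hf fK gK; exists f; split=> //; exists g. Qed.

Lemma tensor_bm_hom M N P (f : M -> N -> P) :
    balanced f -> (forall a m n, f (lact a m) n = lact a (f m n)) ->
    (forall m n a, f m (ract n a) = ract (f m n) a) ->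
  @bm_hom A (tensor M N) P (tlift f).
Proof.
move=> fb fl fr; have fD := tliftD fb; split=> // [a x|x a]; move: x.
  apply: tensor_ext => [x y|x y|m n].
  - by rewrite [lact a _]tn_lactDr fD.
  - by rewrite fD lactDr.
  by rewrite [lact a _]tn_lact_pure !tlift_pure.
apply: tensor_ext => [x y|x y|m n].
- by rewrite [ract _ a]tn_ractDl fD.
- by rewrite fD ractDl.
by rewrite [ract _ a]tn_ract_pure !tlift_pure.
Qed.

Lemma tensor_iso M M' N N' :
  bm_iso M M' -> bm_iso N N' -> bm_iso (tensor M N) (tensor M' N').
Proof.
have bal (X X' Y Y' : bimodule A) (h : X -> X') (k : Y -> Y') :
    bm_hom h -> bm_hom k -> balanced (fun x y => pure (h x) (k y)).
  move=> [hD hl hr] [kD kl kr]; split=> [n m m'|m n n'|m a n].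
  - by rewrite hD pureDl.
  - by rewrite kD pureDr.
  - by rewrite hr kl pure_balanced.
case=> f [hf [f' fK f'K]] [g [hg [g' gK g'K]]].
have hf' := bm_hom_inv hf fK f'K; have hg' := bm_hom_inv hg gK g'K.
have b1 := bal _ _ _ _ _ _ hf hg; have b2 := bal _ _ _ _ _ _ hf' hg'.
apply: (@bm_iso_can (tensor M N) (tensor M' N')
          (tlift (fun m n => pure (f m) (g n)))
          (tlift (fun m n => pure (f' m) (g' n)))).
- case: (hf) (hg) => [fD fl fr] [gD gl gr].
  apply: (tensor_bm_hom (P := tensor M' N') b1) => [a m n|m n a].
    by rewrite fl [RHS]tn_lact_pure.
  by rewrite gr [RHS]tn_ract_pure.
- apply: tensor_ext => // [x y|m n]; first by rewrite !tliftD.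
  by rewrite (tlift_pure _ _ b1) (tlift_pure _ _ b2) fK gK.
- apply: tensor_ext => // [x y|m n]; first by rewrite !tliftD.
  by rewrite (tlift_pure _ _ b2) (tlift_pure _ _ b1) f'K g'K.
Qed.

Lemma tensor_regl M : bm_iso (tensor (regular_bm A) M) M.
Proof.
have b : @balanced A (regular_bm A) M M (fun a m => lact a m).
  split=> [n m m'|m n n'|m a n]; first by rewrite lactDl.
    by rewrite lactDr.
  exact: lactM.
apply: (@bm_iso_can (tensor (regular_bm A) M) M (tlift _)
          (fun m => @pure A (regular_bm A) M 1 m)).
- apply: (tensor_bm_hom b) => [a m n|m n a]; first exact: lactM.
  exact: lractA.
- apply: tensor_ext => // [x y|a m]; first by rewrite tliftD // pureDr.
  by rewrite (tlift_pure _ _ b) -pure_balanced [ract _ _]mul1r.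
- by move=> m; rewrite (tlift_pure _ _ b) lact1.
Qed.

Lemma tensor_regr M : bm_iso (tensor M (regular_bm A)) M.
Proof.
have b : @balanced A M (regular_bm A) M (fun m a => ract m a).
  split=> [n m m'|m n n'|m a n]; first by rewrite ractDl.
    by rewrite ractDr.
  by rewrite -ractM.
apply: (@bm_iso_can (tensor M (regular_bm A)) M (tlift _)
          (fun m => @pure A M (regular_bm A) m 1)).
- apply: (tensor_bm_hom b) => [a m n|m n a]; first by rewrite lractA.
  exact: ractM.
- apply: tensor_ext => // [x y|m a]; first by rewrite tliftD // pureDl.
  by rewrite (tlift_pure _ _ b) pure_balanced [lact _ _]mulr1.
- by move=> m; rewrite (tlift_pure _ _ b) ract1.
Qed.

Lemma assocr_balanced M N P (p : P) :
  balanced (fun m n => pure m (pure n p : tensor N P) : tensor M (tensor N P)).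
Proof.
split=> [n m m'|m n n'|m a n]; rewrite ?pureDl ?pureDr //.
by rewrite pure_balanced [lact a _]tn_lact_pure.
Qed.

Lemma assocl_balanced M N P (m : M) :
  balanced (fun n p => pure (pure m n : tensor M N) p : tensor (tensor M N) P).
Proof.
split=> [p n n'|n p p'|n a p]; rewrite ?pureDr ?pureDl //.
by rewrite -pure_balanced; congr (pure _ p); rewrite [RHS]tn_ract_pure.
Qed.

Lemma tensorA M N P :
  bm_iso (tensor M (tensor N P)) (tensor (tensor M N) P).
Proof.
pose h m n p := pure (pure m n : tensor M N) p : tensor (tensor M N) P.
pose k m n p := pure m (pure n p : tensor N P) : tensor M (tensor N P).
have bh m : balanced (h m) by exact: assocl_balanced.
have bk p : balanced (fun m n => k m n p) by exact: assocr_balanced.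
have bH : @balanced A M (tensor N P) (tensor (tensor M N) P)
            (fun m x => tlift (h m) x).
  split=> [x m m'|m|m a x]; [move: x | exact: tliftD | move: x].
    apply: tensor_ext; first exact: tliftD.
      by move=> x y; rewrite !tliftD // addrACA.
    by move=> n p; rewrite !tlift_pure // /h !pureDl.
  apply: tensor_ext; first exact: tliftD.
    by move=> x y; rewrite [lact a _]tn_lactDr tliftD.
  move=> n p; rewrite [lact a _]tn_lact_pure !tlift_pure // /h.
  by rewrite pure_balanced.
have bK : @balanced A (tensor M N) P (tensor M (tensor N P))
            (fun x p => tlift (fun m n => k m n p) x).
  split=> [p|x p p'|x a p]; [exact: tliftD | move: x | move: x].
    apply: tensor_ext; first exact: tliftD.
      by move=> x y; rewrite !tliftD // addrACA.
    by move=> m n; rewrite !tlift_pure // /k !pureDr.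
  apply: tensor_ext.
  - by move=> x y; rewrite [ract _ a]tn_ractDl tliftD.
  - exact: tliftD.
  move=> m n; rewrite [ract _ a]tn_ract_pure !tlift_pure // /k.
  by rewrite pure_balanced.
apply: (@bm_iso_can (tensor M (tensor N P)) (tensor (tensor M N) P)
          (@tlift A M (tensor N P) (tensor (tensor M N) P)
            (fun m x => tlift (h m) x))
          (@tlift A (tensor M N) P (tensor M (tensor N P))
            (fun x p => tlift (fun m n => k m n p) x))).
- apply: (tensor_bm_hom (P := tensor (tensor M N) P) bH) => [a m x|m x a].
    move: x; apply: tensor_ext; first exact: tliftD.
      by move=> x y; rewrite tliftD // lactDr.
    move=> n p; rewrite !tlift_pure // /h [RHS]tn_lact_pure.
    by congr (pure _ p); rewrite [RHS]tn_lact_pure.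
  move: x; apply: tensor_ext.
  - by move=> x y; rewrite [ract _ a]tn_ractDl tliftD.
  - by move=> x y; rewrite tliftD // ractDl.
  move=> n p; rewrite [ract _ a]tn_ract_pure !tlift_pure // /h.
  by rewrite [RHS]tn_ract_pure.
- apply: tensor_ext => // [x y|m x]; first by rewrite !tliftD.
  rewrite (tlift_pure _ _ bH); move: x; apply: tensor_ext.
  - by move=> x y; rewrite !tliftD.
  - by move=> x y; rewrite pureDr.
  by move=> n p; rewrite (tlift_pure _ _ (bh m)) (tlift_pure _ _ bK) tlift_pure.
- apply: tensor_ext => // [x y|x p]; first by rewrite !tliftD.
  rewrite (tlift_pure _ _ bK); move: x; apply: tensor_ext.
  - by move=> x y; rewrite !tliftD.
  - by move=> x y; rewrite pureDl.
  by move=> m n; rewrite (tlift_pure _ _ (bk p)) (tlift_pure _ _ bH) tlift_pure.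
Qed.

Definition bm_inverse M N :=
  bm_iso (tensor M N) (regular_bm A) /\ bm_iso (tensor N M) (regular_bm A).

Definition invertible M := exists N, bm_inverse M N.

Lemma bm_inverse_iso M M' N N' :
  bm_iso M M' -> bm_iso N N' -> bm_inverse M N -> bm_inverse M' N'.
Proof.
move=> iM iN [h1 h2]; split.
  by apply: bm_iso_trans h1; apply: tensor_iso; exact: bm_iso_sym.
by apply: bm_iso_trans h2; apply: tensor_iso; exact: bm_iso_sym.
Qed.

Lemma bm_inverse_uniq M N N' :
  bm_inverse M N -> bm_inverse M N' -> bm_iso N N'.
Proof.
move=> [_ NM] [MN' _].
apply: bm_iso_trans (bm_iso_sym (tensor_regr N)) _.
apply: bm_iso_trans (tensor_iso (bm_iso_refl N) (bm_iso_sym MN')) _.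
apply: bm_iso_trans (tensorA _ _ _) _.
apply: bm_iso_trans (tensor_iso NM (bm_iso_refl N')) _.
exact: tensor_regl.
Qed.

Lemma bm_inverse_tensor M M' N N' :
  bm_inverse M M' -> bm_inverse N N' ->
  bm_inverse (tensor M N) (tensor N' M').
Proof.
have cancel3 X X' Y Y' : bm_iso (tensor X X') (regular_bm A) ->
    bm_iso (tensor Y Y') (regular_bm A) ->
    bm_iso (tensor (tensor X Y) (tensor Y' X')) (regular_bm A).
  move=> hX hY; apply: bm_iso_trans hX.
  apply: bm_iso_trans (bm_iso_sym (tensorA X Y _)) _.
  apply: tensor_iso (bm_iso_refl X) _.
  apply: bm_iso_trans (tensorA _ _ _) _.
  by apply: bm_iso_trans (tensor_iso hY (bm_iso_refl _)) (tensor_regl _).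
by move=> [h1 h2] [k1 k2]; split; apply: cancel3.
Qed.

End TensorIso.

Section Pic.
Variables (F : fieldType) (A : algType F).
Implicit Types M N T : bimodule A.

Definition symmetric_bm M := forall (k : F) (m : M), lact k%:A m = ract m k%:A.

Lemma symmetric_iso M N : bm_iso M N -> symmetric_bm M -> symmetric_bm N.
Proof.
move=> /bm_iso_sym [f [[_ fl fr] fB]] sM k n; apply: (bij_inj fB).
by rewrite fl fr sM.
Qed.

Lemma symmetric_regular : symmetric_bm (regular_bm A).
Proof.
move=> k m; change (k%:A * m = m * k%:A).
by rewrite -scalerAl -scalerAr mul1r mulr1.
Qed.

Lemma symmetric_tensor M N :
  symmetric_bm M -> symmetric_bm N -> symmetric_bm (tensor M N).
Proof.
move=> sM sN k; apply: tensor_ext; first exact: tn_lactDr.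
  exact: tn_ractDl.
move=> m n; rewrite [lact _ _]tn_lact_pure [ract _ _]tn_ract_pure.
by rewrite sM -sN pure_balanced.
Qed.

Lemma symmetric_inverse M N : symmetric_bm M -> bm_inverse M N -> symmetric_bm N.
Proof.
move=> sM [MN NM].
have sNM := symmetric_iso (bm_iso_sym NM) symmetric_regular.
have e1 k (n : N) (m : M) :
    pure (lact k%:A n) m = pure (ract n k%:A) m :> tensor N M.
  have := sNM k (pure n m).
  by rewrite [lact _ _]tn_lact_pure [ract _ _]tn_ract_pure -sM -pure_balanced.
have e2 k (n : N) (t : tensor M N) :
    pure (lact k%:A n) t = pure (ract n k%:A) t :> tensor N (tensor M N).
  move: t; apply: tensor_ext => [x y|x y|m n']; try by rewrite pureDr.
  have b := @assocr_balanced A N M N n'.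
  by rewrite -!(tlift_pure _ _ b) e1.
case: MN => g [[gD gl gr] [g' gK g'K]] k n.
have b : @balanced A N (tensor M N) N (fun n t => ract n (g t)).
  split=> [t n1 n2|n1 t t'|n1 a t]; first by rewrite ractDl.
    by rewrite gD ractDr.
  by rewrite gl -ractM.
have := congr1 (tlift (fun n t => ract n (g t))) (e2 k n (g' 1)).
by rewrite !tlift_pure // g'K !ract1.
Qed.

Lemma invertible_regular : bm_inverse (regular_bm A) (regular_bm A).
Proof. by split; exact: tensor_regl. Qed.

(* Elements of the Picard group are isomorphism classes, given as predicates  *)
(* on bimodules.                                                              *)
Record picClass := PicClass {
  pic_pred :> bimodule A -> Prop;
  picP : exists M, [/\ invertible M, symmetric_bm M & pic_pred = bm_iso M]
}.

Lemma pic_eq (c d : picClass) : pic_pred c = pic_pred d -> c = d.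
Proof.
case: c d => [P p] [Q r] /= e; rewrite -{Q}e in r *.
by congr PicClass; exact: Prop_irrelevance.
Qed.

Definition pic_class M (iM : invertible M) (sM : symmetric_bm M) : picClass :=
  PicClass (ex_intro _ M (And3 iM sM erefl)).

Lemma bm_iso_eq M N : bm_iso M N -> bm_iso M = bm_iso N.
Proof.
move=> i; apply: funext => T; apply: propext; split; apply: bm_iso_trans => //.
exact: bm_iso_sym.
Qed.

Lemma pic_classP M N iM sM iN sN :
  @pic_class M iM sM = @pic_class N iN sN <-> bm_iso M N.
Proof.
split=> [/(congr1 pic_pred) /= ->|/bm_iso_eq e]; first exact: bm_iso_refl.
exact: pic_eq.
Qed.

Lemma pic_ind (P : picClass -> Prop) :
  (forall M iM sM, P (@pic_class M iM sM)) -> forall c, P c.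
Proof.
move=> h c; have [M [iM sM e]] := picP c.
by rewrite (_ : c = pic_class iM sM) //; exact: pic_eq.
Qed.

Definition pic_rep (c : picClass) : bimodule A := projT1 (cid (picP c)).
Lemma pic_rep_inv c : invertible (pic_rep c).
Proof. by rewrite /pic_rep; case: cid => M []. Qed.
Lemma pic_rep_sym c : symmetric_bm (pic_rep c).
Proof. by rewrite /pic_rep; case: cid => M []. Qed.
Lemma pic_rep_iso M iM sM : bm_iso (pic_rep (@pic_class M iM sM)) M.
Proof. 
by rewrite /pic_rep; case: cid => N [_ _ /= <-]; exact: bm_iso_refl.
Qed.

Lemma invertible_tensor M N :
  invertible M -> invertible N -> invertible (tensor M N).
Proof.
by move=> [M' hM] [N' hN]; exists (tensor N' M'); exact: bm_inverse_tensor.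
Qed.

(* [M] * [N] = [N (x)_A M]: this is the order of the factors for which        *)
(* s |-> A^s is multiplicative, automorphisms being multiplied as in aut_mul, *)
(* since A^s (x)_A A^t is isomorphic to A^(s \o t).                           *)
Definition pic_mul (c d : picClass) : picClass :=
  pic_class (invertible_tensor (pic_rep_inv d) (pic_rep_inv c))
            (symmetric_tensor (@pic_rep_sym d) (@pic_rep_sym c)).

Definition pic_one : picClass :=
  pic_class (ex_intro _ _ invertible_regular) symmetric_regular.

Definition bm_inv (M : bimodule A) (iM : invertible M) := projT1 (cid iM).
Lemma bm_invP M iM : bm_inverse M (@bm_inv M iM).
Proof. exact: projT2 (cid iM). Qed.
Lemma bm_inv_invertible M iM : invertible (@bm_inv M iM).
Proof. by exists M; have [] := bm_invP iM. Qed.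

Definition pic_inv (c : picClass) : picClass :=
  pic_class (bm_inv_invertible (pic_rep_inv c))
    (symmetric_inverse (@pic_rep_sym c) (bm_invP (pic_rep_inv c))).

Lemma pic_mulE M N iM sM iN sN :
  pic_mul (@pic_class M iM sM) (@pic_class N iN sN)
    = pic_class (invertible_tensor iN iM) (symmetric_tensor sN sM).
Proof. by apply/pic_classP/tensor_iso; exact: pic_rep_iso. Qed.

Lemma pic_mulA : associative pic_mul.
Proof.
elim/pic_ind=> M iM sM; elim/pic_ind=> N iN sN; elim/pic_ind=> P iP sP.
rewrite !pic_mulE; apply/pic_classP/bm_iso_sym; exact: tensorA.
Qed.
Lemma pic_mul1 : left_id pic_one pic_mul.
Proof.
elim/pic_ind=> M iM sM; rewrite pic_mulE; apply/pic_classP; exact: tensor_regr.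
Qed.
Lemma pic_mulr1 : right_id pic_one pic_mul.
Proof.
elim/pic_ind=> M iM sM; rewrite pic_mulE; apply/pic_classP; exact: tensor_regl.
Qed.
Lemma pic_mulV : left_inverse pic_one pic_inv pic_mul.
Proof.
elim/pic_ind=> M iM sM; rewrite pic_mulE; apply/pic_classP.
set N := bm_inv _; have [h _] : bm_inverse _ N := bm_invP _.
apply: bm_iso_trans h; apply: tensor_iso (bm_iso_refl _).
by apply: bm_iso_sym; exact: pic_rep_iso.
Qed.
Lemma pic_mulrV : right_inverse pic_one pic_inv pic_mul.
Proof.
elim/pic_ind=> M iM sM; rewrite pic_mulE; apply/pic_classP.
set N := bm_inv _; have [_ h] : bm_inverse _ N := bm_invP _.
apply: bm_iso_trans h; apply: tensor_iso (bm_iso_refl _) _.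
by apply: bm_iso_sym; exact: pic_rep_iso.
Qed.

Definition Pic : largeGroup :=
  LargeGroup pic_mulA pic_mul1 pic_mulr1 pic_mulV pic_mulrV.

Definition twisted_lact (s : algAut A) (a m : A) : A := aut_inv s a * m.

Fact twisted_lactDl s (m : A) : {morph (twisted_lact s)^~ m : a b / a + b}.
Proof.
move=> a b; rewrite /twisted_lact -mulrDl; congr (_ * _).
by have := aut_inv_linear s 1 a b; rewrite !scale1r.
Qed.
Fact twisted_lactDr s (a : A) : {morph twisted_lact s a : m n / m + n}.
Proof. exact: mulrDr. Qed.
Fact twisted_lact1 s (m : A) : twisted_lact s 1 m = m.
Proof. by rewrite /twisted_lact (aut_inv_monoid s).1 mul1r. Qed.
Fact twisted_lactM s (a b m : A) :
  twisted_lact s (a * b) m = twisted_lact s a (twisted_lact s b m).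
Proof. by rewrite /twisted_lact (aut_inv_monoid s).2 mulrA. Qed.
Fact twisted_lractA s (a m b : A) :
  twisted_lact s a (m * b) = twisted_lact s a m * b.
Proof. exact: mulrA. Qed.

Definition twisted (s : algAut A) : bimodule A :=
  @Bimodule A A (twisted_lact s) *%R
    (@twisted_lactDl s) (@twisted_lactDr s) (@twisted_lact1 s)
    (@twisted_lactM s) (fun a m n => mulrDl m n a) (@mulrDr A)
    (@mulr1 A) (@mulrA A)
    (@twisted_lractA s).

Lemma twisted1 : bm_iso (twisted 1%g) (regular_bm A).
Proof. by exists idfun; split; [split | exists idfun]. Qed.

Lemma twistedM (s t : algAut A) :
  bm_iso (tensor (twisted t) (twisted s)) (twisted (s * t)%g).
Proof.
have b : @balanced A (twisted t) (twisted s) (twisted (s * t)%g)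
           (fun m n : A => aut_inv s m * n).
  split=> [n m m'|m n n'|m a n].
  - exact: (twisted_lactDl s).
  - exact: mulrDr.
  by rewrite /= (aut_inv_monoid s).2 /twisted_lact mulrA.
apply: (@bm_iso_can A (tensor (twisted t) (twisted s)) (twisted (s * t)%g)
          (tlift _) (fun n => @pure A (twisted t) (twisted s) 1 n)).
- apply: (tensor_bm_hom (P := twisted (s * t)%g) b) => [a m n|m n a].
    by rewrite /= /twisted_lact /= (aut_inv_monoid s).2 mulrA.
  exact: mulrA.
- apply: tensor_ext => // [x y|m n]; first by rewrite tliftD // pureDr.
  rewrite (tlift_pure _ _ b).
  rewrite -[LHS](@pure_balanced A (twisted t) (twisted s) 1 m n).
  by congr (pure _ n); exact: mul1r.
- by move=> n; rewrite (tlift_pure _ _ b) (aut_inv_monoid s).1 mul1r.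
Qed.

Lemma twisted_inverse (s : algAut A) :
  bm_inverse (twisted s) (twisted s^-1%g).
Proof.
split; apply: bm_iso_trans (twistedM _ _) _.
  by rewrite mulVg; exact: twisted1.
by rewrite mulgV; exact: twisted1.
Qed.

Lemma twisted_symmetric (s : algAut A) : symmetric_bm (twisted s).
Proof.
move=> k m; change (aut_inv s k%:A * m = m * k%:A).
have sZ : aut_inv s k%:A = k%:A.
  have := aut_inv_linear s k 1 0; rewrite !addr0 (aut_inv_monoid s).1.
  by rewrite (_ : aut_inv s 0 = 0) ?addr0 //; apply: morphD0 => x y;
    have := aut_inv_linear s 1 x y; rewrite !scale1r.
by rewrite sZ -scalerAl -scalerAr mul1r mulr1.
Qed.

Definition Omega (s : algAut A) : Pic :=
  pic_class (ex_intro _ _ (twisted_inverse s)) (@twisted_symmetric s).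

Lemma OmegaM (s t : algAut A) : Omega (s * t)%g = lg_mul (Omega s) (Omega t).
Proof.
rewrite [RHS]pic_mulE; apply/pic_classP/bm_iso_sym; exact: twistedM.
Qed.

End Pic.

Section PicardModel.
Variables (F : fieldType) (q : Fstar F).

Definition torus_SL2Z := semidirect (SL2Z_action (@Fstar_mulC F)).
Definition torus_modQ_SL2Z := semidirect (SL2Z_action (@FstarModQ_mulC F q)).
HB.instance Definition _ := Group.on torus_SL2Z.
HB.instance Definition _ := Group.on torus_modQ_SL2Z.

Definition torus_elt (al be : Fstar F) : torus_SL2Z := Semidirect _ (al, be) 1%g.
Definition sl2_elt (g : SL2Z) : torus_SL2Z := Semidirect _ 1%g g.

Definition mod_q (w : torus_SL2Z) : torus_modQ_SL2Z :=
  Semidirect _ (fsq_pi q (sd_n w).1, fsq_pi q (sd_n w).2) (sd_h w).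

Lemma mod_qM : {morph mod_q : u v / (u * v)%g}.
Proof.
have piM (x y : Fstar F) : fsq_pi q (x * y)%g = (fsq_pi q x * fsq_pi q y)%g.
  by rewrite [RHS]fsq_piM.
have piX (x : Fstar F) (m : nat) : fsq_pi q (x ^+ m)%g = (fsq_pi q x ^+ m)%g.
  by elim: m => [|m IH]; rewrite ?expg0 // !expgS piM IH.
have piZ (x : Fstar F) n : fsq_pi q (expgz x n) = expgz (fsq_pi q x) n.
  by case: n => m; rewrite /= ?piX // -piX [RHS]fsq_piV.
move=> [[x y] g] [[x' y'] h].
by congr Semidirect; rewrite /= /torus_act /= !piM !piZ.
Qed.

Record is_identification (theta : torus_SL2Z -> algAut (qtorus q)) : Prop := {
  ident_bij : bijective theta;
  identM : {morph theta : u v / (u * v)%g};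
  ident_torus : forall al be : Fstar F,
    theta (torus_elt al be) (qx q) = fs_val al *: qx q /\
    theta (torus_elt al be) (qy q) = fs_val be *: qy q;
  ident_g1 : theta (sl2_elt sl2_g1) (qx q) = qy q * qx q /\
             theta (sl2_elt sl2_g1) (qy q) = qy q;
  ident_g2 : theta (sl2_elt sl2_g2) (qx q) = qx q /\
             theta (sl2_elt sl2_g2) (qy q) = qy q * qxV q;
  ident_sl2 : forall g : SL2Z, exists al be : Fstar F,
    theta (sl2_elt g) (qx q)
      = fs_val al *: (qy_pow q (sl2_mx g 0 1) * qx_pow q (sl2_mx g 0 0)) /\
    theta (sl2_elt g) (qy q)
      = fs_val be *: (qy_pow q (sl2_mx g 1 1) * qx_pow q (sl2_mx g 1 0))
}.

End PicardModel.

(* Main.v *)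
Require Import Defs.
From HB Require Import structures.
From mathcomp Require Import all_boot all_order all_algebra monoid.
From mathcomp Require Import boolp reals complex.
From mathcomp Require Import ring zify.
Set Implicit Arguments.
Unset Strict Implicit.
Unset Printing Implicit Defensive.
Import Order.TTheory GRing.Theory Num.Theory.
Local Open Scope ring_scope.

(* The units of A are the scalar monomials, so an automorphism is given by a  *)
(* matrix of determinant 1 and two scalars, and Omega kills exactly the       *)
(* conjugations by monomials, i.e. the torus elements (q^i, q^j).             *)
(*                                                                            *)
(* Omega is onto: let M be an invertible bimodule. Since A is an Ore domain,  *)
(* a functional M -> A from the Morita context is injective, so M is a right  *)
(* ideal, of rank one; hence left multiplication by the unit x shifts the     *)
(* degree in each direction w by a constant c_w, and c_(-w) = - c_w because   *)
(* this also applies to x^n for all integers n. So for suitable u and v in    *)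
(* Z^2 the operators m |-> x m mon(-u) and m |-> y m mon(-v) preserve a       *)
(* nonzero finite-dimensional space of elements supported in a box. They      *)
(* commute up to q^(1 - det(u, v)); taking determinants, det(u, v) = 1 and    *)
(* they commute. On a common eigenvector m, x m = m (k mon(u)) and            *)
(* y m = m (l mon(v)), so m A is a sub-bimodule; as A is simple it is all of  *)
(* M, and a |-> m a is an isomorphism from a twist of A to M.                 *)

(** For the automorphisms, a square root [p] of q gives the basis [weyl v], whose multiplication
    involves only the alternating form det(u, v) ([weylM]). This form is invariant under matrices of
    determinant 1, so [weyl v] may be sent to [weyl (v g)], up to a character of Z^2, without
    correcting scalars; this is [theta]. It is onto because automorphisms permute the units, which
    are scalar monomials ([qtorus_unit]), and the relation xy = qyx fixes the determinant of the
    exponents ([theta_surj]).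

    The kernel of [Omega] consists of the inner automorphisms ([Omega_eq1]); conjugation by a
    monomial multiplies x and y by powers of q, and all pairs of powers occur. Hence [Omega] after
    [theta] factors injectively through [mod_q] ([Omega_theta_eq]).

    Surjectivity is [invertible_twisted]. Invertibility embeds M in A as a right module
    ([invertible_embedding]), where degrees are available; [top_shift_opp] and [unit_matrix] turn
    the left actions of x and y into invertible matrices, and [invertible_eigenvector] extracts an
    element m on which both act through right multiplication by scalar monomials.
    [invertible_simple] shows that m generates M. *)

Section IntegerPowers.

(** The [match] is that of [qx_pow] and [qy_pow], which are thus instances up to conversion. *)
Definition zexp (R : nzRingType) (a aV : R) (n : int) : R :=
  match n with Posz m => a ^+ m | Negz m => aV ^+ m.+1 end.

Variables (F : fieldType) (B : algType F) (a aV : B).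
Hypotheses (aaV : a * aV = 1) (aVa : aV * a = 1).

Lemma zexpS n : zexp a aV (n + 1) = zexp a aV n * a.
Proof.
case: n => n; first by rewrite -PoszD addn1 /= exprSr.
case: n => [|n] /=; first by rewrite aVa.
by rewrite subn1 /= [in RHS]exprSr -mulrA aVa mulr1.
Qed.

Lemma zexpP n : zexp a aV (n - 1) = zexp a aV n * aV.
Proof. by rewrite -[n in RHS](subrK 1) zexpS -mulrA aaV mulr1. Qed.

Lemma zexpD m n : zexp a aV (m + n) = zexp a aV m * zexp a aV n.
Proof.
elim/int_rec: n => [|n IH|n IH]; first by rewrite addr0 mulr1.
- by rewrite -addn1 PoszD addrA !zexpS IH mulrA.
- by rewrite -addn1 PoszD opprD addrA !zexpP IH mulrA.
Qed.

Lemma zexp_comm (c : B) (k : F) n : k != 0 -> c * a = k *: (a * c) ->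
  c * zexp a aV n = k ^ n *: (zexp a aV n * c).
Proof.
move=> k0 ca.
have caV : c * aV = k^-1 *: (aV * c).
  rewrite -[c in LHS]mul1r -aVa -!mulrA [a * (c * _)]mulrA.
  by rewrite -[a * c](scalerK k0) -ca -scalerAl -!mulrA aaV mulr1 -scalerAr.
elim/int_rec: n => [|n IH|n IH]; first by rewrite mulr1 mul1r expr0z scale1r.
- rewrite -addn1 PoszD zexpS mulrA IH -scalerAl -[_ * c * a]mulrA ca.
  rewrite -scalerAr mulrA.
  by rewrite scalerA expfzDr.
- rewrite -addn1 PoszD opprD zexpP mulrA IH -scalerAl -[_ * c * aV]mulrA caV.
  rewrite -scalerAr mulrA.
  by rewrite scalerA expfzDr // expr1z.
Qed.

End IntegerPowers.

(** * The monomial basis and coefficients *)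

Section Monomials.
Variables (F : fieldType) (q : Fstar F).
Notation Q := (fs_val q).
Notation A := (qtorus q).
Implicit Types (v w u : int * int) (a b : A) (f g h : int * int -> F).

Lemma Q_neq0 : Q != 0. Proof. exact: fs_neq0. Qed.
Hint Resolve Q_neq0 : core.

Lemma qxxV : qx q * qxV q = 1.
Proof. by rewrite [LHS]qt_piM; apply/qt_piP/qeq_xxV. Qed.
Lemma qxVx : qxV q * qx q = 1.
Proof. by rewrite [LHS]qt_piM; apply/qt_piP/qeq_xVx. Qed.
Lemma qyyV : qy q * qyV q = 1.
Proof. by rewrite [LHS]qt_piM; apply/qt_piP/qeq_yyV. Qed.
Lemma qyVy : qyV q * qy q = 1.
Proof. by rewrite [LHS]qt_piM; apply/qt_piP/qeq_yVy. Qed.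
Lemma qxqy : qx q * qy q = Q *: (qy q * qx q).
Proof.
rewrite [LHS]qt_piM /GRing.scale /= /qt_scale [qy q * qx q]qt_piM /qt_const qt_piM.
exact/qt_piP/qeq_xy.
Qed.

Lemma qx_powD m n : qx_pow q (m + n) = qx_pow q m * qx_pow q n.
Proof. exact: (zexpD qxxV qxVx). Qed.
Lemma qy_powD m n : qy_pow q (m + n) = qy_pow q m * qy_pow q n.
Proof. exact: (zexpD qyyV qyVy). Qed.

Lemma qx_powS n : qx_pow q (n + 1) = qx_pow q n * qx q.
Proof. exact: (zexpS qxVx). Qed.
Lemma qx_powP n : qx_pow q (n - 1) = qx_pow q n * qxV q.
Proof. exact: (zexpP qxxV qxVx). Qed.
Lemma qy_powS n : qy_pow q (n + 1) = qy_pow q n * qy q.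
Proof. exact: (zexpS qyVy). Qed.
Lemma qy_powP n : qy_pow q (n - 1) = qy_pow q n * qyV q.
Proof. exact: (zexpP qyyV qyVy). Qed.

Lemma qx_qy_pow m n :
  qx_pow q m * qy_pow q n = Q ^ (m * n) *: (qy_pow q n * qx_pow q m).
Proof.
have e : qy_pow q n * qx q = Q ^ (- n) *: (qx q * qy_pow q n).
  rewrite (zexp_comm qyyV qyVy n Q_neq0 qxqy) scalerA -expfzDr // addNr.
  by rewrite expr0z scale1r.
have := zexp_comm qxxV qxVx m (expfz_neq0 _ Q_neq0) e.
rewrite -/(qx_pow q m) => ->.
by rewrite scalerA exprz_exp -expfzDr // mulNr mulrC subrr scale1r.
Qed.

Definition mon v : A := qy_pow q v.2 * qx_pow q v.1.

Lemma mon0 : mon 0 = 1. Proof. by rewrite /mon mulr1. Qed.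

Lemma monM v w : mon v * mon w = Q ^ (v.1 * w.2) *: mon (v + w).
Proof.
rewrite /mon -mulrA [qx_pow q v.1 * _]mulrA qx_qy_pow -scalerAl -scalerAr.
by rewrite -mulrA -qx_powD mulrA -qy_powD.
Qed.

Lemma mon_conj v w :
  mon w * mon v = Q ^ (w.1 * v.2 - v.1 * w.2) *: (mon v * mon w).
Proof. by rewrite !monM scalerA -expfzDr // subrK [v + w]addrC. Qed.

Lemma mon_invr v : mon v * (Q ^ (v.1 * v.2) *: mon (- v)) = 1.
Proof.
by rewrite -scalerAr monM scalerA -expfzDr // mulrN subrr scale1r subrr mon0.
Qed.
Lemma mon_invl v : (Q ^ (v.1 * v.2) *: mon (- v)) * mon v = 1.
Proof.
by rewrite -scalerAl monM scalerA -expfzDr // mulNr subrr scale1r addNr mon0.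
Qed.

(* Left multiplication of sum_v f(v) mon(v) by the generators, written on the *)
(* coefficient functions f. *)
Fixpoint qt_act (t : qterm F) (f : int * int -> F) : int * int -> F :=
  match t with
  | QX => fun v => Q ^ v.2 * f (v.1 - 1, v.2)
  | QXinv => fun v => Q ^ (- v.2) * f (v.1 + 1, v.2)
  | QY => fun v => f (v.1, v.2 - 1)
  | QYinv => fun v => f (v.1, v.2 + 1)
  | QConst k => fun v => k * f v
  | QAdd s t => fun v => qt_act s f v + qt_act t f v
  | QMul s t => qt_act s (qt_act t f)
  end.

Lemma qt_actD t f g :
  qt_act t (fun v => f v + g v) = fun v => qt_act t f v + qt_act t g v.
Proof.
elim: t f g => [||||k|s IHs t IHt|s IHs t IHt] f g /=;
  try by apply: funext => v; rewrite ?mulrDr.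
- by rewrite IHs IHt; apply: funext => v; rewrite addrACA.
- by rewrite IHt IHs.
Qed.

Lemma qt_actZ t k f :
  qt_act t (fun v => k * f v) = fun v => k * qt_act t f v.
Proof.
elim: t f => [||||l|s IHs t IHt|s IHs t IHt] f /=;
  try by apply: funext => v; rewrite 1?mulrCA.
- by rewrite IHs IHt; apply: funext => v; rewrite mulrDr.
- by rewrite IHt IHs.
Qed.

(** Each defining relation holds for these operators on arbitrary functions on Z^2, so the action
    descends to the algebra. It separates the monomials ([qcoef_mon]), which gives their linear
    independence. *)
Lemma qt_actP s t : qeq Q s t -> qt_act s = qt_act t.
Proof.
elim=> {s t} /=; try by move=> *; apply/funext => f; apply/funext => v //=;
  rewrite ?(mulrDl, mulrDr, mul0r, mulN1r, addNr, add0r, mul1r, mulrA) // addrC.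
- by move=> s t _ ->.
- by move=> s t u _ -> _ ->.
- by move=> s s' t t' _ -> _ ->.
- by move=> s s' t t' _ -> _ ->.
- by move=> s t u; apply/funext => f; apply/funext => v; rewrite addrA.
- by move=> t; apply/funext => f; congr qt_act; apply/funext => v; rewrite mul1r.
- by move=> s t u; apply/funext => f; rewrite qt_actD.
- by move=> a t; apply/funext => f; rewrite qt_actZ.
- apply/funext => f; apply/funext => -[i j] /=.
  by rewrite mulrA -expfzDr // subrr expr0z subrK.
- apply/funext => f; apply/funext => -[i j] /=.
  by rewrite mulrA -expfzDr // addNr expr0z addrK.
- by apply/funext => f; apply/funext => -[i j] /=; rewrite subrK mul1r.
- by apply/funext => f; apply/funext => -[i j] /=; rewrite addrK mul1r.
- apply/funext => f; apply/funext => -[i j] /=.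
  rewrite [RHS]mulrA; congr (_ * _).
  by rewrite -[X in X * _]expr1z -expfzDr // addrC subrK.
Qed.

Definition qact a : (int * int -> F) -> int * int -> F := qt_act (rep a).

Lemma qact_pi t : qact (qt_pi q t) = qt_act t.
Proof. by apply: qt_actP; apply: rep_cls; exact: qeq_equiv. Qed.

Lemma qactM a b h : qact (a * b) h = qact a (qact b h).
Proof.
by elim/qt_ind: a => s; elim/qt_ind: b => t; rewrite [_ * _]qt_piM !qact_pi.
Qed.

Lemma qactD a b h v : qact (a + b) h v = qact a h v + qact b h v.
Proof.
by elim/qt_ind: a => s; elim/qt_ind: b => t; rewrite [_ + _]qt_piD !qact_pi.
Qed.

Lemma qactZ k a h v : qact (k *: a) h v = k * qact a h v.
Proof.
by rewrite [k *: a](_ : _ = qt_const q k * a) // qactM qact_pi.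
Qed.

Lemma qact_qx n h v : qact (qx_pow q n) h v = Q ^ (n * v.2) * h (v.1 - n, v.2).
Proof.
case: v => i j /=; elim/int_rec: n h i => [|n IH|n IH] h i.
- rewrite mul0r expr0z mul1r subr0.
  by rewrite [qx_pow q 0](_ : _ = qt_pi q (QConst 1)) // qact_pi /= mul1r.
- rewrite -addn1 PoszD qx_powS qactM IH qact_pi /=.
  by rewrite mulrA -expfzDr // mulrDl mul1r opprD addrA.
- rewrite -addn1 PoszD opprD qx_powP qactM IH.
  by rewrite qact_pi /= mulrA -expfzDr // mulrBl mul1r opprD addrA opprK.
Qed.

Lemma qact_qy n h v : qact (qy_pow q n) h v = h (v.1, v.2 - n).
Proof.
case: v => i j /=; elim/int_rec: n h j => [|n IH|n IH] h j.
- by rewrite subr0 [qy_pow q 0](_ : _ = qt_pi q (QConst 1)) // qact_pi /= mul1r.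
- rewrite -addn1 PoszD qy_powS qactM IH qact_pi /=.
  by rewrite opprD addrA.
- rewrite -addn1 PoszD opprD qy_powP qactM IH.
  by rewrite qact_pi /= opprD addrA opprK.
Qed.

(** The function acted upon is the coefficient function of 1, so the result is that of [a * 1]. *)
Definition qcoef a v : F := qact a (fun w => (w == 0)%:R) v.

Lemma qcoefD a b v : qcoef (a + b) v = qcoef a v + qcoef b v.
Proof. exact: qactD. Qed.
Lemma qcoefZ k a v : qcoef (k *: a) v = k * qcoef a v.
Proof. exact: qactZ. Qed.
Lemma qcoef0 v : qcoef 0 v = 0.
Proof. by rewrite -(scale0r 0) qcoefZ mul0r. Qed.
Lemma qcoefN a v : qcoef (- a) v = - qcoef a v.
Proof. by rewrite -scaleN1r qcoefZ mulN1r. Qed.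
Lemma qcoefB a b v : qcoef (a - b) v = qcoef a v - qcoef b v.
Proof. by rewrite qcoefD qcoefN. Qed.
Lemma qcoef_sum I (r : seq I) (G : I -> A) v :
  qcoef (\sum_(i <- r) G i) v = \sum_(i <- r) qcoef (G i) v.
Proof.
by elim: r => [|i r IH]; rewrite ?big_nil ?qcoef0 // !big_cons qcoefD IH.
Qed.

Lemma qcoef_monMl v a u :
  qcoef (mon v * a) u = Q ^ (v.1 * (u - v).2) * qcoef a (u - v).
Proof. by rewrite /qcoef qactM /mon qactM qact_qy qact_qx. Qed.

Lemma qcoef_mon v u : qcoef (mon v) u = (u == v)%:R.
Proof.
have := qcoef_monMl v 1 u; rewrite mulr1 => ->.
rewrite {1}/qcoef (_ : 1 = qt_pi q (QConst 1)) // qact_pi /= mul1r subr_eq0.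
by case: eqVneq => [->|_]; rewrite ?mulr0 //= subrr mulr0 expr0z mulr1.
Qed.

Lemma mon_sum a : exists r : seq (F * (int * int)),
  a = \sum_(i <- r) i.1 *: mon i.2.
Proof.
pose P a := exists r : seq (F * (int * int)), a = \sum_(i <- r) i.1 *: mon i.2.
have P1 k v : P (k *: mon v) by exists [:: (k, v)]; rewrite big_seq1.
have PD b c : P b -> P c -> P (b + c).
  by move=> [r ->] [s ->]; exists (r ++ s); rewrite big_cat.
have P0 : P 0 by exists [::]; rewrite big_nil.
have PM b c : P b -> P c -> P (b * c).
  move=> [r ->] [s ->]; rewrite mulr_suml; apply: big_ind => // i _.
  rewrite mulr_sumr; apply: big_ind => // j _.
  by rewrite -scalerAl -scalerAr monM !scalerA.
have PM1 v : P (mon v) by rewrite -[mon v]scale1r.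
rewrite -/(P a); elim/qt_ind: a; elim=> [||||k|s IHs t IHt|s IHs t IHt].
- by have := PM1 (1, 0); rewrite /mon mul1r.
- by have := PM1 (-1, 0); rewrite /mon mul1r.
- by have := PM1 (0, 1); rewrite /mon mulr1.
- by have := PM1 (0, -1); rewrite /mon mulr1.
- have := P1 k 0; rewrite mon0 [k *: 1](_ : _ = qt_mul (qt_const q k) 1) //.
  by rewrite [qt_mul _ _](@mulr1 A).
- by rewrite -qt_piD; exact: PD.
- by rewrite -qt_piM; exact: PM.
Qed.

(** A difference is a finite combination of monomials by [mon_sum]; once equal exponents are
    collected, the scalar at each monomial is a value of [qcoef], hence zero. *)
Lemma qcoef_inj a b : qcoef a =1 qcoef b -> a = b.
Proof.
move=> ab; apply/eqP; rewrite -subr_eq0; apply/eqP.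
have {ab} : qcoef (a - b) =1 fun=> 0 by move=> v; rewrite qcoefB ab subrr.
have [r -> r0] := mon_sum (a - b).
pose S := undup (unzip2 r).
rewrite big_seq.
(* Each inner sum has at most one nonzero term; it allows the exchange of sums that collects
   repeated exponents. *)
transitivity (\sum_(i <- r | i \in r) \sum_(v <- S) (i.1 * (v == i.2)%:R) *: mon v).
  apply: eq_bigr => i ir; rewrite (bigD1_seq i.2) ?undup_uniq //=; last first.
    by rewrite mem_undup; exact: map_f.
  rewrite eqxx mulr1 big1 ?addr0 // => v /negPf ->.
  by rewrite mulr0 scale0r.
rewrite exchange_big big1 //= => v _; rewrite -scaler_suml -big_seq.
rewrite (_ : \sum_(i <- r) _ = 0) ?scale0r // -[RHS](r0 v) qcoef_sum.
by apply: eq_bigr => i _; rewrite qcoefZ qcoef_mon.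
Qed.

Lemma qcoef_neq0 a : a != 0 -> exists v, qcoef a v != 0.
Proof.
move=> /eqP a0; apply: contrapT => nv; apply/a0/qcoef_inj => v.
by rewrite qcoef0; apply/eqP; apply: contrapT => h; apply: nv; exists v; apply/negP.
Qed.

Definition supported (S : seq (int * int)) a :=
  forall v, qcoef a v != 0 -> v \in S.

Lemma supported_ex a : exists2 S, uniq S & supported S a.
Proof.
have [r ->] := mon_sum a; exists (undup (unzip2 r)); first exact: undup_uniq.
move=> v; rewrite mem_undup qcoef_sum; apply: contra_neqT => vr.
rewrite big_seq big1 // => i ir; rewrite qcoefZ qcoef_mon.
have [vi|] := eqVneq v i.2; last by rewrite mulr0.
by case/negP: vr; rewrite vi; exact: map_f.
Qed.

Lemma supportedE S a : uniq S -> supported S a ->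
  a = \sum_(v <- S) qcoef a v *: mon v.
Proof.
move=> uS sa; apply: qcoef_inj => w; rewrite qcoef_sum.
under eq_bigr do rewrite qcoefZ qcoef_mon.
have [wS|/negPf wS] := boolP (w \in S).
  rewrite (bigD1_seq w) //= eqxx mulr1 big1 ?addr0 // => v.
  by rewrite eq_sym => /negPf ->; rewrite mulr0.
rewrite (contraFeq (sa w) wS) big_seq big1 // => v vS.
by have [wv|] := eqVneq w v; [rewrite wv vS in wS | rewrite mulr0].
Qed.

Lemma qcoefM S a b u : uniq S -> supported S a -> qcoef (a * b) u =
  \sum_(v <- S) qcoef a v * Q ^ (v.1 * (u - v).2) * qcoef b (u - v).
Proof.
move=> uS sa; rewrite {1}(supportedE uS sa) mulr_suml qcoef_sum.
by apply: eq_bigr => v _; rewrite -scalerAl qcoefZ qcoef_monMl mulrA.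
Qed.

Lemma qcoef_monMr a v u :
  qcoef (a * mon v) u = Q ^ ((u - v).1 * v.2) * qcoef a (u - v).
Proof.
have [S uS sa] := supported_ex a.
rewrite {1}(supportedE uS sa) mulr_suml qcoef_sum.
rewrite (_ : qcoef a (u - v) = qcoef (\sum_(w <- S) qcoef a w *: mon w) (u - v));
  last by rewrite -supportedE.
rewrite qcoef_sum mulr_sumr; apply: eq_bigr => w _.
rewrite -scalerAl monM !qcoefZ !qcoef_mon subr_eq.
by case: eqVneq => [->|]; rewrite ?mulr0 ?mulr1 ?addrK // mulrC.
Qed.

End Monomials.

(** * Degrees in a direction of Z^2; zero divisors and units *)

Section Degrees.
Variables (F : fieldType) (q : Fstar F).
Notation Q := (fs_val q).
Notation A := (qtorus q).
Implicit Types (u v w : int * int) (a b : A).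

Definition dot w v : int := w.1 * v.1 + w.2 * v.2.

Lemma dotD w v u : dot w (v + u) = dot w v + dot w u.
Proof. by rewrite /dot /=; ring. Qed.
Lemma dotB w v u : dot w (v - u) = dot w v - dot w u.
Proof. by rewrite /dot /=; ring. Qed.
Lemma dotN w v : dot w (- v) = - dot w v.
Proof. by rewrite /dot /=; ring. Qed.
Lemma dotNl w v : dot (- w) v = - dot w v.
Proof. by rewrite /dot /=; ring. Qed.

(** [w] and its rotation by a right angle are independent: their determinant is the sum of squares
    [N]. *)
Lemma dot_inj w v u : w != 0 -> dot w v = dot w u ->
  dot (- w.2, w.1) v = dot (- w.2, w.1) u -> v = u.
Proof.
case: w v u => [a b] [i j] [k l] w0; rewrite /dot /= => e1 e2.
have N : a * a + b * b != 0.
  by move: w0; rewrite (_ : 0 = (0, 0)) // xpair_eqE negb_and => /orP [] /eqP; nia.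
congr (_, _); apply: (mulfI N).
- transitivity (a * (a * i + b * j) - b * (- b * i + a * j)); first by ring.
  by rewrite e1 e2; ring.
- transitivity (b * (a * i + b * j) + a * (- b * i + a * j)); first by ring.
  by rewrite e1 e2; ring.
Qed.

Lemma max_in (T : eqType) (S : seq T) (P : T -> Prop) (key : T -> int) :
  (exists2 x, x \in S & P x) ->
  exists x, [/\ x \in S, P x & forall y, y \in S -> P y -> key y <= key x].
Proof.
elim: S => [[x]|s S IH [x]] //.
have [SP _|nSP] := pselect (exists2 x, x \in S & P x); last first.
  rewrite inE => /orP [/eqP ->|xS] Px; last by case: nSP; exists x.
  exists s; split=> // [|y]; rewrite inE ?eqxx // => /orP [/eqP -> //|yS] Py.
  by case: nSP; exists y.
have [m [mS Pm mM] _] := IH SP.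
have [[Ps sm]|nsm] := pselect (P s /\ key m <= key s).
  exists s; split=> // [|y]; rewrite inE ?eqxx // => /orP [/eqP -> //|yS] Py.
  exact: le_trans (mM y yS Py) sm.
exists m; split=> // [|y]; rewrite inE ?mS ?orbT // => /orP [/eqP ->|]; last exact: mM.
move=> Ps; rewrite leNgt; apply/negP => /ltW ms; exact: nsm.
Qed.

(** [n] is the value at [w] of the support function of the Newton polygon of [a]. Being a relation,
    it needs no convention at [a = 0], where no [n] qualifies. *)
Definition top w a (n : int) :=
  (forall v, qcoef a v != 0 -> dot w v <= n) /\
  (exists2 v, qcoef a v != 0 & dot w v = n).

Lemma top_exists w a : a != 0 -> exists n, top w a n.
Proof.
move=> a0; have [S _ sa] := supported_ex a; have [v av] := qcoef_neq0 a0.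
have [|m [_ am mM]] := @max_in _ S (fun v => qcoef a v != 0) (dot w).
  by exists v => //; exact: sa.
by exists (dot w m); split=> [u au|]; [apply: mM => //; exact: sa | exists m].
Qed.

Lemma top_uniq w a n m : top w a n -> top w a m -> n = m.
Proof.
move=> [n1 [v v0 vn]] [m1 [u u0 um]]; apply/eqP; rewrite eq_le.
by rewrite -{1}vn m1 //= -um n1.
Qed.

Lemma top_opp w a n m : top w a n -> top (- w) a m -> 0 <= n + m.
Proof.
move=> [n1 [v v0 vn]] [m1 _]; have := m1 v v0; rewrite dotNl vn; lia.
Qed.

Lemma top_neq0 w a n : top w a n -> a != 0.
Proof. by move=> [_ [v v0 _]]; apply: contra_neq v0 => ->; exact: qcoef0. Qed.

Lemma top_mon w v : top w (mon q v) (dot w v).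
Proof.
split=> [u|]; last by exists v => //; rewrite qcoef_mon eqxx oner_eq0.
by rewrite qcoef_mon; case: (eqVneq u v) => [-> //|_]; rewrite eqxx.
Qed.

(* Ties are broken lexicographically: the maximal points of the two supports  *)
(* for (dot w, dot w') contribute a single term to the product.               *)
Lemma topM w a b n m : w != 0 -> top w a n -> top w b m -> top w (a * b) (n + m).
Proof.
move=> w0 [an an'] [bm bm'].
have [S uS sa] := supported_ex a; have [T uT sb] := supported_ex b.
split=> [u|].
  rewrite (qcoefM _ _ uS sa) => u0.
  have [v vS] : exists2 v, v \in S &
      qcoef a v * Q ^ (v.1 * (u - v).2) * qcoef b (u - v) != 0.
    apply: contrapT => h; move/eqP: u0; apply; rewrite big_seq big1 // => v vS.
    by apply/eqP; apply: contrapT => /negP ?; apply: h; exists v.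
  rewrite !mulf_eq0 !negb_or => /andP [/andP [av _] bv].
  by have := an v av; have := bm _ bv; rewrite dotB; lia.
pose w' := (- w.2, w.1).
have [|v0 [v0S [av0 wv0] v0M]] := @max_in _ S
    (fun v => qcoef a v != 0 /\ dot w v = n) (dot w').
  by case: an' => v av wv; exists v => //; exact: sa.
have [|u0 [u0S [bu0 wu0] u0M]] := @max_in _ T
    (fun v => qcoef b v != 0 /\ dot w v = m) (dot w').
  by case: bm' => v bv wv; exists v => //; exact: sb.
exists (v0 + u0); last by rewrite dotD wv0 wu0.
rewrite (qcoefM _ _ uS sa) (bigD1_seq v0) //= big1_seq => [|v /andP [vv0 vS]].
  rewrite addr0 [v0 + u0]addrC addrK !mulf_neq0 //.
  by rewrite expfz_neq0 // fs_neq0.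
apply: contrapT => /eqP; rewrite !mulf_eq0 !negb_or => /andP [/andP [av _] bv].
have wv := an v av; have := bm _ bv; rewrite dotB dotD wv0 wu0 => wu.
have wvn : dot w v = n by lia.
have wum : dot w (v0 + u0 - v) = m by rewrite dotB dotD; lia.
have w'v := v0M v vS (conj av wvn).
have := u0M _ (sb _ bv) (conj bv wum); rewrite dotB dotD => w'u.
move/eqP: vv0; apply; apply: (dot_inj w0); first by rewrite wvn wv0.
by rewrite -/w'; lia.
Qed.

Lemma qtorus_mulf_neq0 a b : a != 0 -> b != 0 -> a * b != 0.
Proof.
have w0 : (1, 0) != (0 : int * int) by [].
move=> /(top_exists (1, 0)) [n an] /(top_exists (1, 0)) [m bm].
exact: top_neq0 (topM w0 an bm).
Qed.

(** Adding the degrees in directions [w] and [- w], the widths of [a] and [b] sum to the width of 1,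
    which is zero. Both are nonnegative by [top_opp], so [a] has width zero in every direction and
    its support is a point. *)
Lemma qtorus_unit a b : a * b = 1 ->
  exists v, exists2 k : F, k != 0 & a = k *: mon q v.
Proof.
move=> ab1.
have ab0 : a * b != 0 by rewrite ab1 oner_eq0.
have a0 : a != 0 by apply: contra_neq ab0 => ->; rewrite mul0r.
have b0 : b != 0 by apply: contra_neq ab0 => ->; rewrite mulr0.
have key w v u : w != 0 -> qcoef a v != 0 -> qcoef a u != 0 -> dot w v <= dot w u.
  move=> w0 av au.
  have Nw0 : - w != 0 by rewrite oppr_eq0.
  have [n an] := top_exists w a0; have [m bm] := top_exists w b0.
  have [n' an'] := top_exists (- w) a0; have [m' bm'] := top_exists (- w) b0.
  have t1 z : top z (a * b) 0.
    by rewrite ab1 -mon0; have := top_mon z 0; rewrite /dot !mulr0.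
  have e := top_uniq (topM w0 an bm) (t1 w).
  have e' := top_uniq (topM Nw0 an' bm') (t1 _).
  have := top_opp bm bm'; have := an.1 _ av; have := an'.1 _ au.
  by rewrite dotNl; lia.
have [v av] := qcoef_neq0 a0; exists v; exists (qcoef a v) => //.
apply: qcoef_inj => u; rewrite qcoefZ qcoef_mon.
case: eqVneq => [->|]; first by rewrite mulr1.
apply: contra_neqP => /eqP au; rewrite mulr0 in au *.
have e w : w != 0 -> dot w u = dot w v.
  by move=> w0; apply/eqP; rewrite eq_le !key.
by apply: (@dot_inj (1, 0)) => //; exact: e.
Qed.

End Degrees.

(** * Square boxes in Z^2 *)

Section Boxes.

Definition zrange (c : nat) : seq int := [seq k%:Z - c%:Z | k <- iota 0 c.*2.+1].
Definition box (c : nat) : seq (int * int) :=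
  [seq (i, j) | i <- zrange c, j <- zrange c].

Lemma mem_zrange c i : (i \in zrange c) = (- c%:Z <= i <= c%:Z).
Proof.
apply/mapP/idP => [[k]|ic]; first by rewrite mem_iota => kc ->; lia.
by exists (absz (i + c%:Z)); rewrite ?mem_iota; lia.
Qed.

Lemma mem_box c v : (v \in box c) = (v.1 \in zrange c) && (v.2 \in zrange c).
Proof.
case: v => i j; apply/allpairsP/andP => [[[i' j'] [/= ? ? [-> ->]]] //|[ic jc]].
by exists (i, j).
Qed.

Lemma box_uniq c : uniq (box c).
Proof.
have uz : uniq (zrange c).
  by rewrite map_inj_uniq ?iota_uniq // => i j /addIr [].
by apply: allpairs_uniq => // -[i j] [k l].
Qed.

Lemma size_box c : size (box c) = (c.*2.+1 * c.*2.+1)%N.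
Proof. by rewrite size_allpairs size_map size_iota. Qed.

Lemma box_cover (S : seq (int * int)) : exists c, {subset S <= box c}.
Proof.
elim: S => [|[i j] S [c IH]]; first by exists 0%N.
exists (c + absz i + absz j)%N => v; rewrite inE => /orP [/eqP ->|/IH];
  by rewrite !mem_box !mem_zrange /=; lia.
Qed.

End Boxes.

(** * Elements with support in a finite set, and the Ore condition *)

Section Combinations.
Variables (F : fieldType) (q : Fstar F).
Notation A := (qtorus q).
Implicit Types (S T : seq (int * int)) (a b : A).

Definition comb S (x : 'rV[F]_(size S)) : A :=
  \sum_i x 0 i *: mon q (tnth (in_tuple S) i).

Lemma comb_linear S k x y : comb (k *: x + y) = k *: comb x + @comb S y.
Proof.
rewrite scaler_sumr -big_split; apply: eq_bigr => i _.
by rewrite !mxE scalerDl scalerA.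
Qed.

Lemma qcoef_comb S (x : 'rV_(size S)) i :
  uniq S -> qcoef (comb x) (tnth (in_tuple S) i) = x 0 i.
Proof.
move=> uS; rewrite qcoef_sum (bigD1 i) //= qcoefZ qcoef_mon eqxx mulr1.
rewrite big1 ?addr0 // => j ji; rewrite qcoefZ qcoef_mon.
by rewrite (inj_eq (tuple_uniqP (in_tuple S) uS)) eq_sym (negPf ji) mulr0.
Qed.

Lemma comb_inj S : uniq S -> injective (@comb S).
Proof. by move=> uS x y xy; apply/rowP => i; rewrite -!qcoef_comb // xy. Qed.

Lemma comb_supported S (x : 'rV_(size S)) : supported S (comb x).
Proof.
move=> v; apply: contra_neqT => vS; rewrite qcoef_sum big1 // => i _.
rewrite qcoefZ qcoef_mon; case: (eqVneq v _) => [vi|_]; last exact: mulr0.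
by rewrite vi mem_tnth in vS.
Qed.

Lemma supported_comb S a : uniq S -> supported S a -> exists x, a = @comb S x.
Proof.
move=> uS sa; exists (\row_i qcoef a (tnth (in_tuple S) i)).
by rewrite {1}(supportedE uS sa) big_tnth; apply: eq_bigr => i _; rewrite mxE.
Qed.

Lemma supported_mulr k n a b : supported (box k) a -> supported (box n) b ->
  supported (box (k + n)) (a * b).
Proof.
move=> sa sb v; rewrite (qcoefM _ _ (box_uniq k) sa); apply: contra_neqT => vkn.
rewrite big_seq big1 // => u uk; have [->|/sb] := eqVneq (qcoef b (v - u)) 0.
  by rewrite mulr0.
by move: uk vkn; rewrite !mem_box !mem_zrange /=; lia.
Qed.

Lemma supported_sub S T a : {subset S <= T} -> supported S a -> supported T a.
Proof. by move=> ST sa v /sa /ST. Qed.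

Lemma supported_box a : exists k, supported (box k) a.
Proof.
have [S _ sa] := supported_ex a; have [k Sk] := box_cover S.
by exists k; exact: supported_sub sa.
Qed.

(* Dimension count: for large n, multiplying two copies of box n by a and b   *)
(* lands in box (n + k), which has fewer than twice as many points. *)
Lemma qtorus_ore a b : a != 0 -> b != 0 ->
  exists c d, a * c = b * d /\ a * c != 0.
Proof.
move=> a0 b0; have [ka sa] := supported_box a; have [kb sb] := supported_box b.
(* There are 2(2n+1)^2 unknowns and (2(k+n)+1)^2 equations; with n = 4k this reads 2(8k+1)^2 >
   (10k+1)^2. *)
pose k := (ka + kb)%N; pose n := (4 * k)%N.
have sub m m' : (m <= m')%N -> {subset box m <= box m'}.
  by move=> mm v; rewrite !mem_box !mem_zrange; lia.
have {}sa : supported (box k) a.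
  by apply: supported_sub sa; apply: sub; rewrite leq_addr.
have {}sb : supported (box k) b.
  by apply: supported_sub sb; apply: sub; rewrite leq_addl.
pose S := box n; pose T := box (k + n).
pose D f := \matrix_(i < size S, j < size T)
  qcoef (f * mon q (tnth (in_tuple S) i)) (tnth (in_tuple T) j).
have DE f x j : (x *m D f) 0 j = qcoef (f * comb x) (tnth (in_tuple T) j).
  rewrite mxE mulr_sumr qcoef_sum; apply: eq_bigr => i _.
  by rewrite !mxE -scalerAr qcoefZ.
pose K := col_mx (D a) (- D b).
have : kermx K != 0.
  rewrite -mxrank_eq0 mxrank_ker; move: (rank_leq_col K).
  by move: (\rank K) => r; rewrite !size_box /n -!addnn; nia.
case/rowV0Pn => x /sub_kermxP; rewrite -[x]hsubmxK mul_row_col mulmxN.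
move: (lsubmx x) (rsubmx x) => c d /eqP; rewrite subr_eq0 => /eqP cd x0.
have e : a * comb c = b * comb d.
  apply: qcoef_inj => v; have [vT|vT] := boolP (v \in T).
    have /tnthP [j ->] : v \in in_tuple T by [].
    by rewrite -!DE cd.
  have sc f x' : supported (box k) f -> qcoef (f * @comb S x') v = 0.
    move=> sf; apply: contraNeq vT.
    exact: (supported_mulr sf (@comb_supported _ _)).
  by rewrite !sc.
exists (comb c), (comb d); split=> //; apply: qtorus_mulf_neq0 => //.
apply: contra_neq x0 => c0.
have z0 : @comb S 0 = 0 by rewrite /comb big1 // => i _; rewrite mxE scale0r.
have d0 : comb d = 0.
  apply/eqP; apply: contraT => d0; have := qtorus_mulf_neq0 b0 d0.
  by rewrite -e c0 mulr0 eqxx.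
rewrite (comb_inj (box_uniq n) (etrans c0 (esym z0))).
by rewrite (comb_inj (box_uniq n) (etrans d0 (esym z0))) row_mx0.
Qed.

End Combinations.

(** * Simplicity of the quantum torus *)

Section Simplicity.
Variables (F : fieldType) (q : Fstar F).
Notation Q := (fs_val q).
Notation A := (qtorus q).
Hypothesis hq : forall n : nat, (0 < n)%N -> Q ^+ n != 1.

Lemma Qexp_inj : injective (fun n : int => Q ^ n).
Proof.
have H (n : int) : Q ^ n = 1 -> n = 0.
  case: n => n /eqP; first by case: n => // n; rewrite (negPf (hq _)).
  by rewrite NegzE -exprz_inv -exprnP exprVn invr_eq1 (negPf (hq _)).
move=> m n mn; apply/eqP; rewrite -subr_eq0; apply/eqP/H.
by rewrite expfzDr ?fs_neq0 //= mn -expfzDr ?fs_neq0 // subrr.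
Qed.

(* Commutators with monomials shorten the support of an element of the ideal. *)
Lemma qtorus_simple (J : A -> Prop) a :
  (forall b c, J b -> J c -> J (b - c)) -> (forall b c, J c -> J (b * c)) ->
  (forall b c, J c -> J (c * b)) -> J a -> a != 0 -> J 1.
Proof.
move=> JB Jl Jr.
have JZ k b : J b -> J (k *: b) by rewrite -[b in J (_ *: b)]mul1r scalerAl; exact: Jl.
have [S uS sa] := supported_ex a.
have [n] := ubnP (size S); elim: n a S uS sa => // n IH a S uS sa Sn Ja a0.
have [v av] := qcoef_neq0 a0.
have [[u [au uv]]|nu] := pselect (exists u, qcoef a u != 0 /\ u != v); last first.
  have aE : a = qcoef a v *: mon q v.
    apply: qcoef_inj => u; rewrite qcoefZ qcoef_mon.
    case: (eqVneq u v) => [->|uv]; first by rewrite mulr1.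
    by rewrite mulr0; apply/eqP; apply: contrapT => /negP au; case: nu; exists u.
  rewrite -(mon_invr q v) -[mon q v](scalerK av) -aE.
  exact/Jr/JZ.
pose det w z : int := w.1 * z.2 - z.1 * w.2.
have [w wuv] : exists w : int * int, det w u != det w v.
  move: uv; case: (u) (v) => [i j] [k l]; rewrite xpair_eqE negb_and.
  case/orP => uv; [exists (0, -1) | exists (1, 0)]; move: uv; rewrite /det /=; lia.
(* The subtracted multiple is the one that cancels the term coming from [v]. The term coming from
   [u] survives, since [det w u] and [det w v] give distinct powers of q. *)
pose b := mon q w * a - Q ^ (det w v) *: (a * mon q w).
have bE z : qcoef b z =
    Q ^ ((z - w).1 * w.2) * (Q ^ det w (z - w) - Q ^ det w v) * qcoef a (z - w).
  rewrite qcoefB qcoefZ qcoef_monMl qcoef_monMr [_ * (_ - _) in RHS]mulrBr [RHS]mulrBl.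
  rewrite -expfzDr ?fs_neq0 //.
  congr (Q ^ _ * _ - _); first by rewrite /det /=; ring.
  by rewrite mulrCA mulrA.
apply: (IH b [seq z + w | z <- rem v S]).
- by rewrite map_inj_uniq ?rem_uniq //; exact: addIr.
- move=> z; rewrite bE !mulf_eq0 !negb_or => /andP [/andP [_ zv] az].
  apply/mapP; exists (z - w); last by rewrite subrK.
  rewrite mem_rem_uniq // inE sa // andbT.
  by apply: contra_neq zv => ->; rewrite subrr.
- by rewrite size_map size_rem ?sa //; have := sa _ av; case: (S) Sn.
- apply: (JB); first exact: Jl.
  exact/JZ/Jr.
- have : qcoef b (u + w) != 0.
    rewrite bE addrK !mulf_neq0 // ?expfz_neq0 ?fs_neq0 // subr_eq0.
    by apply: contra_neq wuv; exact: Qexp_inj.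
  by apply: contra_neq => ->; exact: qcoef0.
Qed.

End Simplicity.

(** * Morphisms out of the quantum torus *)

Section UniversalProperty.
Variables (F : fieldType) (q : Fstar F) (B : algType F).
Notation Q := (fs_val q).
Notation A := (qtorus q).

Section Lift.
Variables X XV Y YV : B.

Fixpoint qlift_term (t : qterm F) : B :=
  match t with
  | QX => X
  | QXinv => XV
  | QY => Y
  | QYinv => YV
  | QConst k => k%:A
  | QAdd s t => qlift_term s + qlift_term t
  | QMul s t => qlift_term s * qlift_term t
  end.

Definition qlift (a : A) : B := qlift_term (rep a).

Hypotheses (XXV : X * XV = 1) (XVX : XV * X = 1).
Hypotheses (YYV : Y * YV = 1) (YVY : YV * Y = 1) (XY : X * Y = Q *: (Y * X)).

Lemma qlift_termP s t : qeq Q s t -> qlift_term s = qlift_term t.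
Proof.
elim=> {s t} //=.
- by move=> s t u _ -> _ ->.
- by move=> s s' t t' _ -> _ ->.
- by move=> s s' t t' _ -> _ ->.
- by move=> s t u; rewrite addrA.
- by move=> s t; rewrite addrC.
- by move=> t; rewrite scale0r add0r.
- by move=> t; rewrite mulr_algl scaleN1r addNr scale0r.
- by move=> s t u; rewrite mulrA.
- by move=> t; rewrite mulr_algl scale1r.
- by move=> t; rewrite mulr_algr scale1r.
- by move=> s t u; rewrite mulrDl.
- by move=> s t u; rewrite mulrDr.
- by move=> a b; rewrite scalerDl.
- by move=> a b; rewrite mulr_algl scalerA.
- by move=> a t; rewrite mulr_algl mulr_algr.
- by rewrite scale1r.
- by rewrite scale1r.
- by rewrite scale1r.
- by rewrite scale1r.
- by rewrite mulr_algl.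
Qed.

Lemma qlift_pi t : qlift (qt_pi q t) = qlift_term t.
Proof. by apply: qlift_termP; apply: rep_cls; exact: qeq_equiv. Qed.

Lemma qlift_monoid : monoid_morphism qlift.
Proof.
split; first by rewrite [1]/(qt_pi q (QConst 1)) qlift_pi /= scale1r.
elim/qt_ind=> s; elim/qt_ind=> t.
by rewrite [_ * _]qt_piM !qlift_pi.
Qed.

Lemma qlift_linear : linear qlift.
Proof.
move=> k; elim/qt_ind=> s; elim/qt_ind=> t.
have -> : k *: qt_pi q s + qt_pi q t = qt_pi q (QAdd (QMul (QConst k) s) t).
  by rewrite -qt_piD -qt_piM.
by rewrite !qlift_pi /= mulr_algl.
Qed.

End Lift.

Lemma qtorus_hom_ext (f g : A -> B) : linear f -> monoid_morphism f ->
  linear g -> monoid_morphism g -> f (qx q) = g (qx q) -> f (qy q) = g (qy q) ->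
  f =1 g.
Proof.
move=> fL [f1 fM] gL [g1 gM] fgx fgy.
have fZ k : f k%:A = k%:A.
  rewrite -f1; have := fL k 1 0; rewrite !addr0 => ->.
  rewrite (_ : f 0 = 0) ?addr0 //.
  by apply: morphD0 => x y; have := fL 1 x y; rewrite !scale1r.
have gZ k : g k%:A = k%:A.
  rewrite -g1; have := gL k 1 0; rewrite !addr0 => ->.
  rewrite (_ : g 0 = 0) ?addr0 //.
  by apply: morphD0 => x y; have := gL 1 x y; rewrite !scale1r.
elim/qt_ind; elim=> [||||k|s IHs t IHt|s IHs t IHt] //.
- rewrite -[RHS]mul1r -f1 -(qxVx q) fM -mulrA fgx -gM.
  by rewrite (qxxV q) g1 mulr1.
- rewrite -[RHS]mul1r -f1 -(qyVy q) fM -mulrA fgy -gM.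
  by rewrite (qyyV q) g1 mulr1.
- have -> : qt_pi q (QConst k) = k%:A by rewrite -[LHS](@mulr1 A).
  by rewrite fZ gZ.
- rewrite -qt_piD -/(qt_pi q s + qt_pi q t).
  have := fL 1 (qt_pi q s) (qt_pi q t); have := gL 1 (qt_pi q s) (qt_pi q t).
  by rewrite !scale1r IHs IHt => <-.
- by rewrite -qt_piM -/(qt_pi q s * qt_pi q t) fM gM IHs IHt.
Qed.

End UniversalProperty.

Lemma expgz_val (F : fieldType) (t : Fstar F) (n : int) :
  fs_val (expgz t n) = fs_val t ^ n.
Proof.
have H m : fs_val (t ^+ m)%g = fs_val t ^+ m.
  by elim: m => // m IH; rewrite expgS exprS /= IH.
by case: n => n; [exact: H | exact: congr1 (H n.+1)].
Qed.

Lemma inj_surj_bij (T U : Type) (f : T -> U) :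
  injective f -> (forall y, exists x, f x = y) -> bijective f.
Proof.
move=> fI fS; exists (fun y => sval (cid (fS y))) => x; last by case: cid.
by apply: fI; case: cid.
Qed.

Lemma mulrZZ (F : fieldType) (B : algType F) (k l : F) (a b : B) :
  (k *: a) * (l *: b) = (k * l) *: (a * b).
Proof. by rewrite -scalerAl -scalerAr scalerA. Qed.

Lemma lift0_ord2 : lift ord0 ord0 = 1 :> 'I_2. Proof. exact: val_inj. Qed.

Lemma det_mx2 (R : comNzRingType) (M : 'M[R]_2) :
  \det M = M 0 0 * M 1 1 - M 0 1 * M 1 0.
Proof.
rewrite (expand_det_row _ ord0) !big_ord_recl big_ord0.
rewrite /cofactor !det_mx11 !mxE /= !lift0_ord2.
have -> : lift (1 : 'I_2) (0 : 'I_1) = 0 by apply: val_inj.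
by rewrite addr0 expr0 expr1 mul1r mulN1r mulrN.
Qed.

Lemma sl2_detE (g : SL2Z) :
  sl2_mx g 0 0 * sl2_mx g 1 1 - sl2_mx g 0 1 * sl2_mx g 1 0 = 1.
Proof. by rewrite -det_mx2 sl2_det. Qed.

(** * The identification of the automorphism group with the semidirect product *)

(* For p^2 = q, weyl (i, j) is the Weyl ordered monomial                      *)
(* p^(ij) (y/p)^j (x/p)^i. Rescaling the generators by p makes the map        *)
(* weyl v |-> weyl (v g) send x to yx for g_1 and y to y x^-1 for g_2, as in  *)
(* the prescribed identification. *)
Section WeylBasis.
Variables (F : fieldType) (q p : Fstar F).
Notation Q := (fs_val q).
Notation P := (fs_val p).
Notation A := (qtorus q).
Hypothesis pq : P ^+ 2 = Q.
Implicit Types (u v : int * int) (w : torus_SL2Z F).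

Let P0 : P != 0. Proof. exact: fs_neq0. Qed.
Let qP n : Q ^ n = P ^ (n * 2). Proof. by rewrite -pq mulrC -exprz_exp. Qed.

Definition weyl v : A := P ^ (v.1 * v.2 - v.1 - v.2) *: mon q v.

(** The factor p^(ij) splits the cocycle of [monM] evenly and leaves its alternating part; the
    remaining factor p^(-i-j) is a character and does not change it. *)
Lemma weylM u v :
  weyl u * weyl v = P ^ (u.1 * v.2 - u.2 * v.1) *: weyl (u + v).
Proof.
rewrite /weyl -scalerAl -scalerAr monM !scalerA qP -!expfzDr //.
by congr (P ^ _ *: _); rewrite /=; ring.
Qed.

Lemma weyl0 : weyl 0 = 1.
Proof. by rewrite /weyl mon0 (_ : _ - _ = 0) // expr0z scale1r. Qed.

Lemma qx_weyl : qx q = P *: weyl (1, 0).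
Proof.
rewrite /weyl scalerA -{1}[P]expr1z -expfzDr // (_ : _ + _ = 0) //.
by rewrite expr0z scale1r /mon /= mul1r.
Qed.
Lemma qy_weyl : qy q = P *: weyl (0, 1).
Proof.
rewrite /weyl scalerA -{1}[P]expr1z -expfzDr // (_ : _ + _ = 0) //.
by rewrite expr0z scale1r /mon /= mulr1.
Qed.

Definition sl2_row v (g : SL2Z) : int * int :=
  (v.1 * sl2_mx g 0 0 + v.2 * sl2_mx g 1 0, v.1 * sl2_mx g 0 1 + v.2 * sl2_mx g 1 1).

Definition torus_char (t : Fstar F * Fstar F) v : F :=
  fs_val t.1 ^ v.1 * fs_val t.2 ^ v.2.

Lemma torus_char_neq0 t v : torus_char t v != 0.
Proof. by rewrite mulf_neq0 // expfz_neq0 // fs_neq0. Qed.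

Lemma torus_charD t u v : torus_char t (u + v) = torus_char t u * torus_char t v.
Proof. by rewrite /torus_char !expfzDr ?fs_neq0 // mulrACA. Qed.

(** The intended image of [weyl v] under the automorphism attached to [w]; see [theta_weyl]. *)
Definition tweyl w v : A := torus_char (sd_n w) v *: weyl (sl2_row v (sd_h w)).

Lemma sl2_rowD u v g : sl2_row (u + v) g = sl2_row u g + sl2_row v g.
Proof. by rewrite /sl2_row; congr (_, _); rewrite /=; ring. Qed.

(** The exponent is det(u, v), which a matrix of determinant 1 preserves. So [tweyl w] multiplies
    exactly as [weyl] does, and the images of x and y satisfy the defining relations. *)
Lemma tweylM w u v :
  tweyl w u * tweyl w v = P ^ (u.1 * v.2 - u.2 * v.1) *: tweyl w (u + v).
Proof.
rewrite /tweyl -scalerAl -scalerAr weylM sl2_rowD torus_charD.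
move: (weyl _) => W; rewrite !scalerA; congr (_ *: _).
rewrite [RHS]mulrC; congr (_ * P ^ _).
rewrite /sl2_row /= -[RHS]mul1r -(sl2_detE (sd_h w)); ring.
Qed.

Lemma tweyl0 w : tweyl w 0 = 1.
Proof.
by rewrite /tweyl /torus_char /sl2_row /= !mul0r addr0 mulr1 scale1r weyl0.
Qed.

Lemma tweylV w v : tweyl w v * tweyl w (- v) = 1.
Proof. by rewrite tweylM subrr tweyl0 /= !mulrN [v.2 * _]mulrC subrr scale1r. Qed.

Lemma tweylVl w v : tweyl w (- v) * tweyl w v = 1.
Proof. by have := tweylV w (- v); rewrite opprK. Qed.

Definition theta_fun w : A -> A :=
  @qlift F q A (P *: tweyl w (1, 0)) (P^-1 *: tweyl w (- (1, 0)))
        (P *: tweyl w (0, 1)) (P^-1 *: tweyl w (- (0, 1))).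

Section Relations.
Variable w : torus_SL2Z F.

Let rV v : (P *: tweyl w v) * (P^-1 *: tweyl w (- v)) = 1.
Proof. by rewrite mulrZZ tweylV mulfV // scale1r. Qed.
Let rVl v : (P^-1 *: tweyl w (- v)) * (P *: tweyl w v) = 1.
Proof. by rewrite mulrZZ tweylVl mulVf // scale1r. Qed.
Let rC : (P *: tweyl w (1, 0)) * (P *: tweyl w (0, 1)) =
  Q *: ((P *: tweyl w (0, 1)) * (P *: tweyl w (1, 0))).
Proof.
rewrite (mulrZZ P P (tweyl w (1, 0))) (mulrZZ P P (tweyl w (0, 1))).
rewrite 2!tweylM [(0, 1) + _]addrC -pq; move: (tweyl _ _) => W.
rewrite !scalerA; congr (_ *: _).
rewrite -[LHS]/(P * P * P) -[RHS]/(P ^+ 2 * (P * P) * P^-1).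
by field.
Qed.

Lemma theta_linear : linear (theta_fun w).
Proof. exact: qlift_linear (rV _) (rVl _) (rV _) (rVl _) rC. Qed.
Lemma theta_monoid : monoid_morphism (theta_fun w).
Proof. exact: qlift_monoid (rV _) (rVl _) (rV _) (rVl _) rC. Qed.
Lemma theta_qx : theta_fun w (qx q) = P *: tweyl w (1, 0).
Proof. exact: qlift_pi (rV _) (rVl _) (rV _) (rVl _) rC QX. Qed.
Lemma theta_qy : theta_fun w (qy q) = P *: tweyl w (0, 1).
Proof. exact: qlift_pi (rV _) (rVl _) (rV _) (rVl _) rC QY. Qed.

Lemma thetaZ k a : theta_fun w (k *: a) = k *: theta_fun w a.
Proof.
have := theta_linear k a 0; rewrite !addr0 => ->.
rewrite (_ : theta_fun w 0 = 0) ?addr0 //.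
by apply: morphD0 => x y; have := theta_linear 1 x y; rewrite !scale1r.
Qed.

(** Both families multiply with the same scalars and agree at the two basis vectors, hence on the
    lattice these generate. *)
Lemma theta_weyl v : theta_fun w (weyl v) = tweyl w v.
Proof.
have [h1 hM] := theta_monoid.
have e0 : theta_fun w (weyl (1, 0)) = tweyl w (1, 0).
  by apply: (scalerI P0); rewrite -thetaZ -qx_weyl theta_qx.
have e1 : theta_fun w (weyl (0, 1)) = tweyl w (0, 1).
  by apply: (scalerI P0); rewrite -thetaZ -qy_weyl theta_qy.
have eD u u' : theta_fun w (weyl u) = tweyl w u ->
    theta_fun w (weyl u') = tweyl w u' ->
    theta_fun w (weyl (u + u')) = tweyl w (u + u').
  move=> eu eu'; apply: (scalerI (expfz_neq0 (u.1 * u'.2 - u.2 * u'.1) P0)).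
  by rewrite -thetaZ -weylM hM eu eu' tweylM.
have eN u : theta_fun w (weyl u) = tweyl w u ->
    theta_fun w (weyl (- u)) = tweyl w (- u).
  move=> eu; rewrite -[LHS]mul1r -(tweylVl w u) -mulrA -eu -hM weylM subrr weyl0.
  by rewrite /= !mulrN [u.2 * _]mulrC subrr scale1r h1 mulr1.
have eX n : theta_fun w (weyl (n, 0)) = tweyl w (n, 0).
  elim/int_rec: n => [|n IH|n IH]; first by rewrite weyl0 tweyl0.
    by rewrite -addn1 PoszD; exact: (eD (n%:Z, 0) (1, 0)).
  by rewrite -addn1 PoszD opprD; exact: (eD (- n%:Z, 0) (- 1, 0) IH (eN _ e0)).
have eY n : theta_fun w (weyl (0, n)) = tweyl w (0, n).
  elim/int_rec: n => [|n IH|n IH]; first by rewrite weyl0 tweyl0.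
    by rewrite -addn1 PoszD; exact: (eD (0, n%:Z) (0, 1)).
  by rewrite -addn1 PoszD opprD; exact: (eD (0, - n%:Z) (0, - 1) IH (eN _ e1)).
case: v => i j; have -> : (i, j) = (i, 0) + (0, j).
  by congr (_, _); rewrite ?addr0 ?add0r.
exact: eD.
Qed.

End Relations.

(** Matrices act on exponents from the right, so applying [w] before [w'] gives [w * w'], in
    agreement with [aut_mul]. *)
Lemma theta_tweyl w w' v : theta_fun w' (tweyl w v) = tweyl (w * w')%g v.
Proof.
rewrite {1}/tweyl thetaZ theta_weyl /tweyl scalerA.
case: w w' => [[t1 t2] g] [[s1 s2] h]; congr (_ *: weyl _).
  rewrite /torus_char /= !expgz_val !expfzMl.
  rewrite !exprz_exp !expfzDr ?fs_neq0 // ![_ * sl2_mx g _ _]mulrC; ring.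
rewrite /sl2_row /=. rewrite !mxE !big_ord_recl !big_ord0 /= !lift0_ord2.
by congr (_, _); ring.
Qed.

Lemma theta_comp w w' : theta_fun w' \o theta_fun w =1 theta_fun (w * w')%g.
Proof.
have [h1 hM] := theta_monoid w; have [k1 kM] := theta_monoid w'.
apply: qtorus_hom_ext; try exact: theta_linear; try exact: theta_monoid.
- by move=> k a b; rewrite /= !theta_linear.
- by split=> [|a b] /=; rewrite ?h1 // hM kM.
- by rewrite /= !theta_qx thetaZ theta_tweyl.
- by rewrite /= !theta_qy thetaZ theta_tweyl.
Qed.

Lemma tweyl1 v : tweyl 1%g v = weyl v.
Proof.
rewrite /tweyl /torus_char /= !exp1rz mulr1 scale1r /sl2_row !mxE /=.
by case: v => i j; rewrite /= !mulr1 !mulr0 addr0 add0r.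
Qed.

Lemma theta1 : theta_fun 1%g =1 id.
Proof.
apply: qtorus_hom_ext; try exact: theta_linear; try exact: theta_monoid => //.
- by [].
- by [].
- by rewrite theta_qx tweyl1 -qx_weyl.
- by rewrite theta_qy tweyl1 -qy_weyl.
Qed.

Lemma theta_VK w : cancel (theta_fun w) (theta_fun w^-1%g).
Proof. by move=> a; rewrite -[LHS]/((_ \o _) a) theta_comp mulgV theta1. Qed.
Lemma theta_KV w : cancel (theta_fun w^-1%g) (theta_fun w).
Proof. by move=> a; rewrite -[LHS]/((_ \o _) a) theta_comp mulVg theta1. Qed.

Definition theta w : algAut A :=
  AlgAut (theta_linear w) (theta_monoid w) (theta_VK w) (theta_KV w).

Lemma theta_qxE w : theta w (qx q) = P *: tweyl w (1, 0).
Proof. exact: theta_qx. Qed.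
Lemma theta_qyE w : theta w (qy q) = P *: tweyl w (0, 1).
Proof. exact: theta_qy. Qed.

Lemma thetaM : {morph theta : w w' / (w * w')%g}.
Proof. by move=> w w'; apply: algAut_inj => a; rewrite [RHS]theta_comp. Qed.

Lemma qcoef_weyl u v : (qcoef (weyl u) v != 0) = (v == u).
Proof.
rewrite qcoefZ qcoef_mon mulf_eq0 (negPf (expfz_neq0 _ P0)) /=.
by case: (v == u); rewrite ?oner_eq0 ?eqxx.
Qed.

Lemma weyl_inj k l u v : k != 0 -> k *: weyl u = l *: weyl v -> u = v /\ k = l.
Proof.
move=> k0 e; have := congr1 (@qcoef F q ^~ u) e; rewrite /= (qcoefZ k) (qcoefZ l) => eu.
have uu : qcoef (weyl u) u != 0 by rewrite qcoef_weyl.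
have uv : u = v.
  apply/eqP; rewrite -qcoef_weyl; apply: contraNneq (mulf_neq0 k0 uu) => h.
  by rewrite eu h mulr0.
by split=> //; apply: (mulIf uu); rewrite eu -uv.
Qed.

Lemma theta_inj : injective theta.
Proof.
move=> w w' e.
have H v : tweyl w v = tweyl w' v.
  by rewrite -!theta_weyl -[LHS]/(theta w (weyl v)) e.
have := weyl_inj (torus_char_neq0 _ _) (H (1, 0)).
have := weyl_inj (torus_char_neq0 _ _) (H (0, 1)).
case: w w' {e H} => [[t1 t2] g] [[s1 s2] h].
rewrite /torus_char /sl2_row /= !expr0z !expr1z !mul1r !mulr1 !mul0r !addr0 !add0r.
move=> [[e10 e11] e2] [[e00 e01] e1].
congr Semidirect; first by congr (_, _); apply: val_inj.
apply/val_inj/matrixP => i j.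
have ord2 (k : 'I_2) : k = 0 \/ k = 1.
  by case: k => [[|[|//]] kP]; [left | right]; apply: val_inj.
by case: (ord2 i) => ->; case: (ord2 j) => ->.
Qed.

Lemma theta_onto_mon (u v : int * int) (k l : F) :
    u.1 * v.2 - u.2 * v.1 = 1 -> k != 0 -> l != 0 ->
  exists w, theta w (qx q) = k *: mon q u /\ theta w (qy q) = l *: mon q v.
Proof.
case: u v => [a b] [c d] /= D k0 l0.
have gP : \det (mx2 a b c d) == 1.
  by rewrite det_mx2 !mxE /= D.
(* The scalar for which [P *: weyl v = e v *: mon q v]; dividing by it gives the torus component. *)
pose e v : F := P * P ^ (v.1 * v.2 - v.1 - v.2).
have e0 v : e v != 0 by rewrite mulf_neq0 // expfz_neq0.
have k0' : k / e (a, b) != 0 by rewrite mulf_neq0 ?invr_eq0.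
have l0' : l / e (c, d) != 0 by rewrite mulf_neq0 ?invr_eq0.
exists (Semidirect _ (FStar k0', FStar l0') (SL2ZMx gP)).
rewrite theta_qx theta_qy /tweyl /torus_char.
rewrite /sl2_row /= !mxE /= !expr0z !expr1z !mul1r !mulr1 !mul0r !addr0 !add0r.
by rewrite /weyl /= !scalerA; split; congr (_ *: _);
  rewrite mulrAC -/(e (_, _)) mulrCA mulfV ?mulr1.
Qed.

Hypothesis hq : forall n : nat, (0 < n)%N -> Q ^+ n != 1.

(** The images of x and y are units, hence scalar monomials. Applying [s] to xy = qyx shows that q
    to the determinant of their exponents is q, so this determinant is 1 because q is not a root of
    unity. *)
Lemma theta_surj s : exists w, theta w = s.
Proof.
have [s1 sM] := aut_monoid s.
have [|u [k k0 xE]] := @qtorus_unit F q (s (qx q)) (s (qxV q)).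
  by rewrite -sM qxxV.
have [|v [l l0 yE]] := @qtorus_unit F q (s (qy q)) (s (qyV q)).
  by rewrite -sM qyyV.
have sZ c a : s (c *: a) = c *: s a.
  have := aut_linear s c a 0; rewrite !addr0 => ->; rewrite (_ : s 0 = 0) ?addr0 //.
  by apply: morphD0 => x y; have := aut_linear s 1 x y; rewrite !scale1r.
have D : u.1 * v.2 - u.2 * v.1 = 1.
  have := congr1 s (qxqy q); rewrite sM sZ sM xE yE -!scalerAl -!scalerAr.
  rewrite mon_conj [v.1 * _]mulrC !scalerA monM !scalerA.
  move/(congr1 (@qcoef F q ^~ (v + u))); rewrite /= !qcoefZ qcoef_mon eqxx !mulr1.
  rewrite (_ : Q * l * k = k * l * Q); last by ring.
  move/(mulIf (expfz_neq0 _ (fs_neq0 q)))/(mulfI (mulf_neq0 k0 l0)).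
  by rewrite -[RHS]expr1z => /(Qexp_inj hq).
have [w [wx wy]] := theta_onto_mon D k0 l0; exists w; apply: algAut_inj.
apply: qtorus_hom_ext; try exact: aut_linear; try exact: aut_monoid.
  by rewrite wx xE.
by rewrite wy yE.
Qed.

Lemma theta_identification : is_identification theta.
Proof.
split.
- exact: inj_surj_bij theta_inj theta_surj.
- exact: thetaM.
- move=> al be; rewrite theta_qxE theta_qyE.
  rewrite /tweyl /torus_char /sl2_row /= !mxE /= !expr0z !expr1z !mul1r !mulr1.
  rewrite !mul0r !addr0 !add0r qx_weyl qy_weyl.
  by split; rewrite [LHS]scalerA [RHS]scalerA mulrC.
- rewrite theta_qxE theta_qyE.
  rewrite /tweyl /torus_char /sl2_row /= !mxE /= !exp1rz !mul1r !mul0r !addr0 !add0r.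
  rewrite !scale1r -qy_weyl; split=> //.
  by rewrite /weyl scalerA -{1}[P]expr1z -expfzDr // -[RHS]scale1r.
- rewrite theta_qxE theta_qyE.
  rewrite /tweyl /torus_char /sl2_row /= !mxE /= !exp1rz !mul1r !mul0r !addr0 !add0r.
  rewrite !scale1r -qx_weyl; split=> //.
  by rewrite /weyl scalerA -{1}[P]expr1z -expfzDr // -[RHS]scale1r.
- move=> g.
  pose e v : F := P * P ^ (v.1 * v.2 - v.1 - v.2).
  have e0 v : e v != 0 by rewrite mulf_neq0 // expfz_neq0.
  exists (FStar (e0 (sl2_mx g 0 0, sl2_mx g 0 1))).
  exists (FStar (e0 (sl2_mx g 1 0, sl2_mx g 1 1))).
  rewrite theta_qxE theta_qyE.
  rewrite /tweyl /torus_char /sl2_row /= !exp1rz !mul1r !mul0r !addr0 !add0r.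
  by rewrite !scale1r /weyl !scalerA.
Qed.

End WeylBasis.

Definition simple_ring (A : nzRingType) := forall (J : A -> Prop) a,
  (forall b c, J b -> J c -> J (b - c)) -> (forall b c, J c -> J (b * c)) ->
  (forall b c, J c -> J (c * b)) -> J a -> a != 0 -> J 1.

(** * Invertible bimodules over a general ring, with domain, simplicity and Ore hypotheses added
    where they serve *)

Section InvertibleBimodules.
Variables (A : nzRingType) (M N : bimodule A).
Hypothesis MN : bm_inverse M N.

Lemma ract_0l (P : bimodule A) a : ract (0 : P) a = 0.
Proof. exact: morphD0 (ractDl a). Qed.
Lemma lact_0l (P : bimodule A) (m : P) : lact 0 m = 0.
Proof. by apply: (addrI (lact 0 m)); rewrite -lactDl !addr0. Qed.
Lemma ract_0r (P : bimodule A) (m : P) : ract m 0 = 0.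
Proof. by apply: (addrI (ract m 0)); rewrite -ractDr !addr0. Qed.
Lemma pure0l (m : M) (n : N) : pure 0 n = 0 :> tensor M N.
Proof. by apply: (addrI (pure 0 n)); rewrite -pureDl !addr0. Qed.

Lemma pure_lact (P S : bimodule A) a (m : P) (n : S) :
  pure (lact a m) n = lact a (pure m n : tensor P S).
Proof. by rewrite [RHS]tn_lact_pure. Qed.
Lemma pure_ract (P S : bimodule A) (m : P) (n : S) a :
  pure m (ract n a) = ract (pure m n : tensor P S) a.
Proof. by rewrite [RHS]tn_ract_pure. Qed.

Lemma invertible_faithful a : (forall m : M, lact a m = 0) -> a = 0.
Proof.
move=> a0; have [[f [[fD fl _] [g _ gK]]] _] := MN.
have z : forall t : tensor M N, lact a t = 0.
  apply: tensor_ext => [|x y|m n]; first exact: tn_lactDr.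
    by rewrite addr0.
  by rewrite [LHS]tn_lact_pure a0 pure0l.
have := fl a (g 1); rewrite z gK [RHS]mulr1 => <-.
exact: morphD0 fD.
Qed.

(** Tensoring [f] with N gives a right linear endomorphism of a module isomorphic to A, hence left
    multiplication by some a. So f m and a m have the same tensor product with every n; contracting
    against N (x) M, whose isomorphism [be] reaches 1, gives f m = a m. The isomorphisms [al] and
    [be] need not be compatible. *)
Lemma invertible_endo (f : M -> M) : {morph f : m m' / m + m'} ->
  (forall m b, f (ract m b) = ract (f m) b) -> exists a, forall m, f m = lact a m.
Proof.
move=> fD fr.
have [[al [[alD all alr] [al' alK al'K]]] [be [[beD bel ber] [be' beK be'K]]]] := MN.
have fb : @balanced A M N (tensor M N) (fun m n => pure (f m) n).
  split=> [n m m'|m n n'|m b n]; first by rewrite fD pureDl.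
    by rewrite pureDr.
  by rewrite fr pure_balanced.
pose phi : tensor M N -> tensor M N := tlift (fun m n => pure (f m) n : tensor M N).
have phir (b : A) : forall t : tensor M N, phi (ract t b) = ract (phi t) b.
  apply: tensor_ext => [x y|x y|m n].
  - by rewrite [ract _ b]tn_ractDl [LHS](tliftD fb).
  - by rewrite [phi _](tliftD fb) [LHS]tn_ractDl.
  rewrite [ract _ b]tn_ract_pure [LHS](tlift_pure _ _ fb).
  by rewrite /phi (tlift_pure _ _ fb) [RHS]tn_ract_pure.
exists (al (phi (al' 1))).
have H (t : tensor M N) : phi t = lact (al (phi (al' 1)) : A) t.
  apply: (can_inj alK); rewrite all.
  have {1}-> : t = ract (al' 1) (al t : A).
    by apply: (can_inj alK); rewrite alr al'K [RHS]mul1r.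
  by rewrite phir alr.
move=> m; move: (al _) H => a H.
have E (n : N) (m' : M) :
    ract (f m) (be (pure n m') : A) = ract (lact a m) (be (pure n m') : A).
  have b : @balanced A M N M (fun x n => ract x (be (pure n m') : A)).
    split=> [y x x'|x y y'|x c y]; first by rewrite ractDl.
      by rewrite pureDl beD ractDr.
    by rewrite pure_lact bel -ractM.
  have := congr1 (tlift (fun x n => ract x (be (pure n m') : A))) (H (pure m n)).
  by rewrite [phi _](tlift_pure _ _ fb) [lact a _]tn_lact_pure !(tlift_pure _ _ b).
have {}E : forall s : tensor N M, ract (f m) (be s : A) = ract (lact a m) (be s : A).
  by apply: tensor_ext => [x y|x y|//]; rewrite beD ractDr.
by have := E (be' 1); rewrite be'K !ract1.
Qed.

(* A functional m |-> <n, m> coming from the isomorphism of N (x) M with A. *)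
Lemma invertible_functional (u : M) : u != 0 -> exists la : M -> A,
  [/\ {morph la : m m' / m + m'}, forall m b, la (ract m b) = la m * b & la u != 0].
Proof.
have [[al [[alD all alr] [al' alK al'K]]] [be [[beD bel ber] [be' beK be'K]]]] := MN.
move=> u0; suff [n nu] : exists n : N, (be (pure n u) : A) != 0.
  exists (fun m => be (pure n m)); split=> // [m m'|m b].
    by rewrite pureDr beD.
  by rewrite pure_ract ber.
(* If every pairing with [u] vanishes, so does every pure tensor of n with [u]; then [al (pure m n)]
   kills [u] for all m and n, and as [al] reaches 1, [u] is zero. *)
apply: contrapT => h; move/eqP: u0; apply.
have h0 (n : N) : pure n u = 0 :> tensor N M.
  apply: (can_inj beK); rewrite (morphD0 beD); apply/eqP; apply: contrapT => /negP nu.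
  by apply: h; exists n.
have E (m : M) (n : N) : lact (al (pure m n) : A) u = 0.
  have b : @balanced A N M M (fun n u => lact (al (pure m n) : A) u).
    split=> [x y y'|y x x'|y c x]; first by rewrite pureDr alD lactDl.
      by rewrite lactDr.
    by rewrite pure_ract alr -lactM.
  by rewrite -(tlift_pure n u b) h0; apply: morphD0; exact: tliftD.
have {}E : forall t : tensor M N, lact (al t : A) u = 0.
  apply: tensor_ext => [x y|x y|//]; first by rewrite alD lactDl.
  by rewrite addr0.
by have := E (al' 1); rewrite al'K lact1.
Qed.

(** For fixed n the map sending m to u <n, m> is right linear with image in u A, so
    [invertible_endo] makes it left multiplication by some a. A suitable n makes it nonzero because
    [be] reaches 1. *)
Lemma invertible_compress (u : M) : u != 0 ->
  exists2 a : A, a != 0 & forall m : M, exists c, lact a m = ract u c.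
Proof.
move=> u0; have [_ [be [[beD bel ber] [be' beK be'K]]]] := MN.
have [n [m0 nz]] : exists (n : N) (m : M), ract u (be (pure n m) : A) != 0.
  apply: contrapT => h; move/eqP: u0; apply.
  have E : forall s : tensor N M, ract u (be s : A) = 0.
    apply: tensor_ext => [x y|x y|n m]; first by rewrite beD ractDr.
      by rewrite addr0.
    by apply/eqP; apply: contrapT => /negP nz; apply: h; exists n, m.
  by have := E (be' 1); rewrite be'K ract1.
have [|m b|a fa] := @invertible_endo (fun m => ract u (be (pure n m) : A)).
- by move=> m m'; rewrite pureDr beD ractDr.
- by rewrite pure_ract ber -ractM.
exists a => [|m]; last by exists (be (pure n m)); rewrite fa.
by apply: contra_neq nz => a0; rewrite fa a0 lact_0l.
Qed.

Hypothesis dom : forall a b : A, a != 0 -> b != 0 -> a * b != 0.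

Lemma invertible_torsion_free (u : M) b : u != 0 -> b != 0 -> ract u b != 0.
Proof.
move=> /invertible_functional [la [laD lar lau]] b0.
have := dom lau b0; rewrite -lar; apply: contra_neq => ->; exact: morphD0 laD.
Qed.

(** The elements a with a M inside K form a two-sided ideal, which is nonzero because
    [invertible_compress] gives some a with a M inside u A. *)
Lemma invertible_simple (K : M -> Prop) u :
  simple_ring A ->
  (forall m m', K m -> K m' -> K (m - m')) -> (forall a m, K m -> K (lact a m)) ->
  (forall a m, K m -> K (ract m a)) -> K u -> u != 0 -> forall m, K m.
Proof.
move=> simple KB Kl Kr Ku /invertible_compress [a a0 au].
suff: forall m : M, K (lact 1 m) by move=> h m; rewrite -[m]lact1.
apply: (simple (fun a => forall m : M, K (lact a m)) a) => //.
- move=> b c Kb Kc m; have -> : lact (b - c) m = lact b m - lact c m.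
    by apply: (addIr (lact c m)); rewrite -lactDl !subrK.
  exact: KB.
- by move=> b c Kc m; rewrite lactM; exact: Kl.
- by move=> b c Kc m; rewrite lactM.
- by move=> m; have [c ->] := au m; exact: Kr.
Qed.

Hypothesis ore : forall a b : A, a != 0 -> b != 0 ->
  exists c d, a * c = b * d /\ a * c != 0.

(** With a M inside u A and b M inside v A, a nonzero common multiple ac = bd carries M into both,
    and by faithfulness it does not kill M. *)
Lemma invertible_uniform (u v : M) : u != 0 -> v != 0 ->
  exists c d, ract u c = ract v d /\ ract u c != 0.
Proof.
move=> /invertible_compress [a a0 au] /invertible_compress [b b0 bv].
have [c [d [cd cd0]]] := ore a0 b0.
have [m m0] : exists m : M, lact (a * c) m != 0.
  apply: contrapT => h; move/eqP: cd0; apply; apply: invertible_faithful => m.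
  by apply/eqP; apply: contrapT => /negP m0; apply: h; exists m.
have [r ur] := au (lact c m); have [s vs] := bv (lact d m).
exists r, s; rewrite -ur -vs -!lactM; split; last exact: m0.
by rewrite cd.
Qed.

Lemma invertible_nonzero : exists u : M, u != 0.
Proof.
apply: contrapT => h; have /eqP := oner_neq0 A; apply.
apply: invertible_faithful => m; rewrite lact1.
by apply/eqP; apply: contrapT => /negP m0; apply: h; exists m.
Qed.

(** A functional nonzero at u is injective: a nonzero v in its kernel would share a nonzero multiple
    u c = v d with u, and [la u * c] would vanish in a domain. *)
Lemma invertible_embedding : exists la : M -> A,
  [/\ {morph la : m m' / m + m'}, forall m b, la (ract m b) = la m * b
    & injective la].
Proof.
have [u u0] := invertible_nonzero.
have [la [laD lar lau]] := invertible_functional u0.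
exists la; split=> // m m' mm'.
apply/eqP; rewrite -subr_eq0; apply/negPn/negP => v0.
have [c [d [cd cd0]]] := invertible_uniform u0 v0.
have c0 : c != 0 by apply: contra_neq cd0 => ->; exact: ract_0r.
have /negP := dom lau c0; apply; rewrite -lar cd lar laD (morphDN laD) mm' subrr.
by rewrite mul0r.
Qed.

End InvertibleBimodules.

(** * Linear algebra: subspaces given by predicates, and common eigenvectors *)

Section FiniteDimension.
Variable F : fieldType.

(** Starting from 0, a vector of [P] outside the current row space is added as long as there is one;
    the induction is on the codimension. *)
Lemma rowspace_of_pred k (P : 'rV[F]_k -> Prop) :
  P 0 -> (forall a u v, P u -> P v -> P (a *: u + v)) ->
  exists B : 'M[F]_k, forall v, P v <-> (v <= B)%MS.
Proof.
move=> P0 PL.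
pose ok (B : 'M[F]_k) := forall v, (v <= B)%MS -> P v.
suff H d (B : 'M[F]_k) : ok B -> (k - \rank B <= d)%N ->
    exists B : 'M[F]_k, forall v, P v <-> (v <= B)%MS.
  apply: (H k 0); last exact: leq_subr.
  by move=> v; rewrite submx0 => /eqP ->.
elim: d B => [|d IH] B Bok rB.
  exists B => v; split; last exact: Bok.
  move=> _; apply: submx_full; rewrite /row_full eqn_leq rank_leq_row.
  by rewrite -subn_eq0 -leqn0.
have [h|[v [Pv vB]]] : (forall v, P v -> (v <= B)%MS) \/
    exists v, P v /\ ~~ (v <= B)%MS.
  apply: contrapT => h; apply: (h); left => v Pv.
  by apply: contrapT => /negP vB; apply: h; right; exists v.
  by exists B => v; split; [exact: h | exact: Bok].
apply: (IH (B + v)%MS).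
  move=> w /sub_addsmxP [[u c] ->] /=; rewrite addrC.
  have [c0 ->] : exists c0 : F, c *m v = c0 *: v.
    by exists (c 0 0); rewrite {1}[c]mx11_scalar mul_scalar_mx.
  by apply: PL => //; apply: Bok; exact: submxMl.
have : (\rank B < \rank (B + v)%MS)%N.
  rewrite ltn_neqAle mxrankS ?addsmxSl // andbT.
  apply: contra vB; rewrite (mxrank_leqif_sup (addsmxSl _ _)).2 addsmx_sub.
  by case/andP.
have := rank_leq_row (B + v)%MS; lia.
Qed.

Lemma linear_mx r (g : 'rV[F]_r -> 'rV[F]_r) :
  linear g -> exists P : 'M[F]_r, forall v, g v = v *m P.
Proof.
move=> gL.
pose f : {linear 'rV[F]_r -> 'rV[F]_r} :=
  HB.pack g (GRing.isLinear.Build F _ _ _ g gL).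
by exists (lin1_mx f) => v; rewrite mul_rV_lin1.
Qed.

End FiniteDimension.

(* Taking determinants in A B = k B A gives k^r = 1. *)
Lemma common_eigenvector_qcomm (F : numClosedFieldType) (r : nat) (k : F)
    (A B : 'M[F]_r) :
  (0 < r)%N -> A \in unitmx -> B \in unitmx -> A *m B = k *: (B *m A) ->
  k ^+ r = 1 /\ (k = 1 -> exists (v : 'rV[F]_r) (a b : F),
    [/\ v != 0, a != 0, b != 0, v *m A = a *: v & v *m B = b *: v]).
Proof.
move=> r0 uA uB AB; split.
  have := congr1 determinant AB; rewrite detZ !det_mulmx [\det B * _]mulrC.
  rewrite -[LHS]mul1r => /mulIf -> //.
  by move: uA uB; rewrite !unitmxE !unitfE => A0 B0; rewrite mulf_neq0.
move=> k1; rewrite k1 scale1r in AB.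
have [v v0 /andP [/sub_rVP [a va] /sub_rVP [b vb]]] := common_eigenvector2 r0 AB.
have nz (C : 'M_r) c : C \in unitmx -> v *m C = c *: v -> c != 0.
  move=> uC vC; apply: contra_neq v0 => c0.
  by rewrite -[v](mulmxK uC) vC c0 scale0r mul0mx.
by exists v, a, b; split=> //; [exact: nz va | exact: nz vb].
Qed.

(** * Every symmetric invertible bimodule over the quantum torus is a twist *)

Section InvertibleQuantumTorus.
Variables (F : numClosedFieldType) (q : Fstar F).
Notation Q := (fs_val q).
Notation A := (qtorus q).
Hypothesis hq : forall n : nat, (0 < n)%N -> Q ^+ n != 1.
Variable M : bimodule A.
Hypotheses (iM : invertible M) (sM : symmetric_bm M).

Let dom := @qtorus_mulf_neq0 F q.
Let ore := @qtorus_ore F q.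

Section Embedding.
Variable la : M -> A.
Hypotheses (laD : {morph la : m m' / m + m'})
  (lar : forall m b, la (ract m b) = la m * b) (la_inj : injective la).

Lemma la_neq0 m : m != 0 -> la m != 0.
Proof. by apply: contra_neq => m0; apply: la_inj; rewrite m0 (morphD0 laD). Qed.

Lemma lact_neq0 (z z' : A) (m : M) : z' * z = 1 -> m != 0 -> lact z m != 0.
Proof.
move=> zz; apply: contra_neq => zm.
by rewrite -[m]lact1 -zz lactM zm (morphD0 (lactDr z')).
Qed.

(* A unit shifts all degrees by the same amount, as any two elements of M     *)
(* have a common multiple. *)
Lemma top_shift (w : int * int) (z z' : A) : w != 0 -> z' * z = 1 ->
  exists c : int, forall m n, top w (la m) n -> top w (la (lact z m)) (n + c).
Proof.
move=> w0 zz; have [N MN] := iM.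
have [m0 m00] := invertible_nonzero MN.
have [n0 top0] := top_exists w (la_neq0 m00).
have [n1 top1] := top_exists w (la_neq0 (lact_neq0 zz m00)).
exists (n1 - n0) => m n topm.
have mn0 : m != 0.
  by apply: contraNneq (top_neq0 topm) => ->; rewrite (morphD0 laD).
have [c [d [cd cd0]]] := invertible_uniform MN ore m00 mn0.
have c0 : c != 0 by apply: contra_neq cd0 => ->; exact: ract_0r.
have d0 : d != 0 by apply: contra_neq cd0; rewrite cd => ->; exact: ract_0r.
have [kc tc] := top_exists w c0; have [kd td] := top_exists w d0.
have [t tz] := top_exists w (la_neq0 (lact_neq0 zz mn0)).
have e1 : n0 + kc = n + kd.
  apply: top_uniq (topM w0 top0 tc) _; rewrite -lar cd lar; exact: topM.
have e2 : n1 + kc = t + kd.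
  apply: top_uniq (topM w0 top1 tc) _.
  rewrite -lar -lractA cd lractA lar; exact: topM.
by have -> : n + (n1 - n0) = t by lia.
Qed.

(** If z shifts the degrees in directions w and -w by c and c', applying it j times changes the
    width by j(c + c'). Widths are nonnegative, so c + c' >= 0; the inverse z' shifts by -c and -c',
    which gives the opposite inequality. *)
Lemma top_shift_opp (w : int * int) (z z' : A) : w != 0 -> z * z' = 1 ->
  z' * z = 1 -> exists c : int,
    (forall m n, top w (la m) n -> top w (la (lact z m)) (n + c)) /\
    (forall m n, top (- w) (la m) n -> top (- w) (la (lact z m)) (n - c)).
Proof.
move=> w0 zz' z'z; have Nw0 : - w != 0 by rewrite oppr_eq0.
have [N MN] := iM; have [m0 m00] := invertible_nonzero MN.
have le x x' (xx : x' * x = 1) c c' :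
    (forall m n, top w (la m) n -> top w (la (lact x m)) (n + c)) ->
    (forall m n, top (- w) (la m) n -> top (- w) (la (lact x m)) (n + c')) ->
    0 <= c + c'.
  move=> hc hc'; have [n tn] := top_exists w (la_neq0 m00).
  have [n' tn'] := top_exists (- w) (la_neq0 m00).
  have H j : exists m, top w (la m) (n + c * j%:Z) /\ top (- w) (la m) (n' + c' * j%:Z).
    elim: j => [|j [m [h h']]]; first by exists m0; rewrite !mulr0 !addr0.
    exists (lact x m); rewrite -addn1 PoszD !mulrDr !mulr1 !addrA.
    by split; [exact: hc | exact: hc'].
  rewrite leNgt; apply/negP => cc0.
  (* Enough iterations to make the initial width n + n' negative. *)
  pose j := (absz (n + n')).+1; have [m [h h']] := H j.
  have h1 : (c + c') * j%:Z <= - 1 * j%:Z by rewrite ler_wpM2r //; lia.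
  have h2 := top_opp h h'; have e : n + c * j%:Z + (n' + c' * j%:Z) =
    n + n' + (c + c') * j%:Z by ring.
  by move: h2 h1; rewrite e /j; move: (_ * _) => y; lia.
have [c hc] := top_shift w0 z'z; have [c' hc'] := top_shift Nw0 z'z.
have [d hd] := top_shift w0 zz'; have [d' hd'] := top_shift Nw0 zz'.
have inv y e e' : (forall m n, top y (la m) n -> top y (la (lact z m)) (n + e)) ->
    (forall m n, top y (la m) n -> top y (la (lact z' m)) (n + e')) -> e + e' = 0.
  move=> he he'; have [n tn] := top_exists y (la_neq0 m00).
  have := he' _ _ (he _ _ tn); rewrite -lactM z'z lact1 => tn'.
  by have := top_uniq tn tn'; lia.
have cd := inv _ _ _ hc hd; have cd' := inv _ _ _ hc' hd'.
have h1 := le _ _ z'z _ _ hc hc'; have h2 := le _ _ zz' _ _ hd hd'.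
by exists c; split=> //; have -> : - c = c' by lia.
Qed.

Definition axis (w : int * int) := w \in [:: (1, 0); (-1, 0); (0, 1); (0, -1)].

(** The exponent u collects the shifts along the two axes, which right multiplication by
    [mon q (- u)] undoes. The four directions of [axis] suffice to control boxes, as used in
    [supported_box_top]. *)
Lemma unit_shift (z z' : A) : z * z' = 1 -> z' * z = 1 ->
  exists u : int * int, forall w, axis w -> forall m n, top w (la m) n ->
    top w (la (ract (lact z m) (mon q (- u)))) n.
Proof.
move=> zz' z'z.
have [c [hc hc']] := @top_shift_opp (1, 0) z z' isT zz' z'z.
have [d [hd hd']] := @top_shift_opp (0, 1) z z' isT zz' z'z.
exists (c, d) => w; rewrite /axis !inE => ww m n tn; rewrite lar.
have w0 : w != 0 by case/or4P: ww => /eqP ->.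
suff tz : top w (la (lact z m)) (n + dot w (c, d)).
  by have := topM w0 tz (top_mon q w (- (c, d))); rewrite dotN addrK.
have e1 : dot (1, 0) (c, d) = c by rewrite /dot /=; ring.
have e2 : dot (-1, 0) (c, d) = - c by rewrite /dot /=; ring.
have e3 : dot (0, 1) (c, d) = d by rewrite /dot /=; ring.
have e4 : dot (0, -1) (c, d) = - d by rewrite /dot /=; ring.
case/or4P: ww tn => /eqP -> tn; rewrite ?e1 ?e2 ?e3 ?e4;
  [exact: hc | exact: hc' | exact: hd | exact: hd'].
Qed.

Lemma supported_box_top c (a b : A) : a != 0 ->
  (forall w, axis w -> forall n, top w a n -> top w b n) ->
  supported (box c) a -> supported (box c) b.
Proof.
move=> a0 ab sa v bv.
have le w : axis w -> dot w v <= c%:Z.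
  move=> ww; have [n tn] := top_exists w a0.
  apply: le_trans ((ab w ww n tn).1 v bv) _; have [_ [u /sa uc <-]] := tn.
  move: ww; rewrite mem_box !mem_zrange in uc; rewrite /axis !inE /dot.
  by case: (u) uc => i j /= uc; case/or4P => /eqP -> /=; lia.
have := le (1, 0) isT; have := le (-1, 0) isT.
have := le (0, 1) isT; have := le (0, -1) isT.
by rewrite mem_box !mem_zrange /dot; case: (v) => i j /=; lia.
Qed.

Definition boxed c (f : A) := exists2 m : M, la m = f & supported (box c) f.

Lemma boxed_basis c : exists r (iota : 'rV[F]_r -> A), [/\ linear iota,
  injective iota & forall f, boxed c f <-> exists v, iota v = f].
Proof.
pose P (v : 'rV[F]_(size (box c))) := boxed c (comb q v).
have [||B PB] := @rowspace_of_pred F _ P.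
- exists 0; last exact: comb_supported.
  by rewrite (morphD0 laD) /comb big1 // => i _; rewrite mxE scale0r.
- move=> k u v [m mu _] [m' mv _]; exists (ract m k%:A + m').
    by rewrite laD lar mu mv comb_linear mulr_algr.
  exact: comb_supported.
pose B' := row_base B.
exists (\rank B), (fun v => comb q (v *m B')); split.
- by move=> k u v; rewrite mulmxDl -scalemxAl comb_linear.
- by move=> u v /(comb_inj (box_uniq c)); exact: row_free_inj (row_base_free B) _ _.
- move=> f; split=> [fU|[v <-]]; last first.
    by apply/PB; rewrite -(eq_row_base B) submxMl.
  have [_ _ sf] := fU; have [x fx] := supported_comb (box_uniq c) sf.
  have /PB : P x by rewrite /P -fx.
  by rewrite -(eq_row_base B) => /submxP [v xv]; exists v; rewrite -xv.
Qed.

(** The operator keeps the degrees in the four axis directions, hence the box, so it acts on the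
    finite-dimensional space [boxed c]. It is injective there because [z] and the monomial are units
    and A is a domain. *)
Lemma unit_matrix c r (iota : 'rV[F]_r -> A) (z z' : A) (u : int * int) :
    linear iota -> injective iota ->
    (forall f, boxed c f <-> exists v, iota v = f) ->
    z' * z = 1 ->
    (forall w, axis w -> forall m n, top w (la m) n ->
      top w (la (ract (lact z m) (mon q (- u)))) n) ->
  exists2 P : 'M[F]_r, P \in unitmx & forall v m, la m = iota v ->
    la (ract (lact z m) (mon q (- u))) = iota (v *m P).
Proof.
move=> iL iI iU z'z zu.
have i0 : iota 0 = 0 by have := iL (-1) 0 0; rewrite scaler0 addr0 scaleN1r addNr.
have ex v : exists v', forall m, la m = iota v ->
    la (ract (lact z m) (mon q (- u))) = iota v'.
  have [m mv sv] : boxed c (iota v) by apply/iU; exists v.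
  have [v' v'E] : exists v', iota v' = la (ract (lact z m) (mon q (- u))).
    apply/iU; exists (ract (lact z m) (mon q (- u))) => //.
    have [m0|m0] := eqVneq m 0.
      rewrite m0 (morphD0 (lactDr z)) ract_0l (morphD0 laD) => w.
      by rewrite qcoef0 eqxx.
    apply: (supported_box_top (la_neq0 m0)) => [w ww n|]; first exact: zu.
    by rewrite mv.
  exists v' => m' m'v; rewrite v'E; congr (la (ract (lact z _) _)).
  by apply: la_inj; rewrite m'v.
pose g v := sval (cid (ex v)).
have gP v m : la m = iota v -> la (ract (lact z m) (mon q (- u))) = iota (g v).
  by move=> mv; rewrite /g; case: cid => v' /= ->.
have laU v : exists m, la m = iota v.
  by have [m mv _] : boxed c (iota v); [apply/iU; exists v | exists m].
have gL : linear g.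
  move=> k v v'; have [m mv] := laU v; have [m' mv'] := laU v'.
  apply: iI; rewrite iL -(gP _ _ mv) -(gP _ _ mv').
  rewrite -(gP _ (ract m k%:A + m')); last by rewrite laD lar mv mv' iL mulr_algr.
  by rewrite lactDr ractDl laD lractA -ractM mulr_algl lar -scalerAr -lar.
have [P gE] := linear_mx gL; exists P; last by move=> v m mv; rewrite -gE; exact: gP.
rewrite -row_free_unit; apply/inj_row_free => v vP; apply: iI; rewrite i0.
have [m mv] := laU v; have := gP _ _ mv; rewrite gE vP i0 lar => h.
rewrite -mv; apply/eqP; apply: contraT => /= lam0.
have m0 : m != 0 by apply: contra_neq lam0 => ->; rewrite (morphD0 laD).
have mon0 : mon q (- u) != 0.
  have := @oner_neq0 A; rewrite -(mon_invr q (- u)).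
  by apply: contra_neq => ->; rewrite mul0r.
by have := dom (la_neq0 (lact_neq0 z'z m0)) mon0; rewrite h eqxx.
Qed.

Lemma invertible_eigenvector : exists (m : M) (u v : int * int) (k l : F),
  [/\ m != 0, k != 0, l != 0, u.1 * v.2 - u.2 * v.1 = 1 &
    lact (qx q) m = ract m (k *: mon q u) /\ lact (qy q) m = ract m (l *: mon q v)].
Proof.
have [u xu] := unit_shift (qxxV q) (qxVx q).
have [v yv] := unit_shift (qyyV q) (qyVy q).
have [N MN] := iM; have [m0 m00] := invertible_nonzero MN.
have [c sc] := supported_box (la m0).
have [r [iota [iL iI iU]]] := boxed_basis c.
have [X uX XE] := unit_matrix iL iI iU (qxVx q) xu.
have [Y uY YE] := unit_matrix iL iI iU (qyVy q) yv.
have i0 : iota 0 = 0 by have := iL (-1) 0 0; rewrite scaler0 addr0 scaleN1r addNr.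
have iZ k x : iota (k *: x) = k *: iota x by have := iL k x 0; rewrite i0 !addr0.
have r0 : (0 < r)%N.
  have [x xm] : exists x, iota x = la m0 by apply/iU; exists m0.
  rewrite lt0n; apply: contra_neq (la_neq0 m00) => r0.
  by subst r; rewrite -xm (thinmx0 x) i0.
have laU x : exists m, la m = iota x.
  by have [m mv _] : boxed c (iota x); [apply/iU; exists x | exists m].
pose D := u.1 * v.2 - u.2 * v.1.
(* On row vectors [Y *m X] applies the operator of y before that of x. Exchanging x and y
   contributes q, and exchanging the two monomials on the right contributes q^(-D); symmetry of M
   moves the scalar q to the right. *)
have comm : Y *m X = Q ^ (1 - D) *: (X *m Y).
  apply/row_matrixP => i; rewrite !rowE; move: (delta_mx 0 i) => x.
  apply: iI; rewrite -scalemxAr iZ !mulmxA; have [m mx] := laU x.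
  rewrite -(XE _ _ (YE _ _ mx)) -(YE _ _ (XE _ _ mx)).
  rewrite !lractA -!ractM -!lactM qxqy mon_conj.
  have -> : lact (Q *: (qy q * qx q)) m = ract (lact (qy q * qx q) m) Q%:A.
    by rewrite -sM -lactM mulr_algl.
  rewrite -ractM mulr_algl scalerA -{1}[Q]expr1z -expfzDr ?fs_neq0 //.
  rewrite [ract _ (_ *: _)](_ : _ = ract (ract (lact (qy q * qx q) m)
    (mon q (- u) * mon q (- v))) (Q ^ (1 - D))%:A).
    by rewrite lar mulr_algr.
  rewrite -ractM mulr_algr; congr (ract _ (Q ^ _ *: _)).
  by rewrite /D /=; ring.
have [Dr eig] := common_eigenvector_qcomm r0 uY uX comm.
have D1 : D = 1.
  have : Q ^ ((1 - D) * r%:Z) = Q ^ 0 by rewrite -exprz_exp -exprnP Dr expr0z.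
  by move/(Qexp_inj hq); nia.
have [|x [b [a [x0 b0 a0 xb xa]]]] := eig; first by rewrite D1 subrr expr0z.
have [m mx] := laU x.
have m_neq0 : m != 0.
  apply: contra_neq x0 => m0'; apply: iI; rewrite i0 -mx m0' (morphD0 laD) //.
(* Undoes the right multiplication by [mon q (- w)], whose inverse is q^(w.1 w.2) times
   [mon q w]. *)
have back (z : A) (w : int * int) (k : F) Z : x *m Z = k *: x ->
    la (ract (lact z m) (mon q (- w))) = iota (x *m Z) ->
    lact z m = ract m ((k * Q ^ (w.1 * w.2)) *: mon q w).
  move=> xZ; rewrite xZ iZ -mx -mulr_algr -lar => /la_inj e.
  rewrite -[LHS]ract1 -(mon_invr q (- w)) ractM e -ractM opprK mulr_algl.
  by rewrite scalerA /= mulrNN.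
exists m, u, v, (a * Q ^ (u.1 * u.2)), (b * Q ^ (v.1 * v.2)); split=> //.
- by rewrite mulf_neq0 // expfz_neq0 // fs_neq0.
- by rewrite mulf_neq0 // expfz_neq0 // fs_neq0.
by split; [exact: back xa (XE _ _ mx) | exact: back xb (YE _ _ mx)].
Qed.

End Embedding.

Variables (p : Fstar F).
Hypothesis pq : fs_val p ^+ 2 = Q.

Lemma invertible_twisted : exists w, bm_iso (twisted (theta pq w)) M.
Proof.
have [N MN] := iM.
have [la [laD lar la_inj]] := invertible_embedding MN dom ore.
have [m [u [v [k [l [m0 k0 l0 D [xm ym]]]]]]] := invertible_eigenvector laD lar la_inj.
have [w [xw yw]] := theta_onto_mon pq D k0 l0.
have [t1 tM] := aut_monoid (theta pq w).
have tL := aut_linear (theta pq w).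
have tD a b : theta pq w (a + b) = theta pq w a + theta pq w b.
  by have := tL 1 a b; rewrite !scale1r.
(* The elements a with this property form a subalgebra closed under inverses, and x and y belong to
   it by the choice of w. *)
have tm a : lact a m = ract m (theta pq w a).
  have inv (z z' : A) : z * z' = 1 -> z' * z = 1 ->
      lact z m = ract m (theta pq w z) -> lact z' m = ract m (theta pq w z').
    move=> zz' z'z zm; rewrite -[lact z' m]ract1 -t1 -zz' tM ractM -lractA -zm.
    by rewrite -lactM z'z lact1.
  have xm' : lact (qx q) m = ract m (theta pq w (qx q)) by rewrite xw.
  have ym' : lact (qy q) m = ract m (theta pq w (qy q)) by rewrite yw.
  elim/qt_ind: a; elim=> [||||c|s IHs t IHt|s IHs t IHt] //.
  - exact: inv (qxxV q) (qxVx q) xm'.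
  - exact: inv (qyyV q) (qyVy q) ym'.
  - have -> : qt_pi q (QConst c) = c%:A by rewrite -[LHS](@mulr1 A).
    by rewrite sM [theta pq w _](thetaZ pq w c 1) (theta_monoid pq w).1.
  - by rewrite -qt_piD -/(qt_pi q s + qt_pi q t) lactDl tD ractDr IHs IHt.
  - by rewrite -qt_piM -/(qt_pi q s * qt_pi q t) lactM tM ractM IHt lractA IHs.
(* The left action on a twist goes through the inverse automorphism, so moving a across m by
   [theta pq w] corresponds to the twist by w^-1. *)
exists w^-1%g; exists (fun a : A => ract m a); split.
  split=> [a b|a b|a b]; first exact: ractDr.
    by rewrite /= /twisted_lact /= invgK ractM lractA tm.
  exact: ractM.
apply: inj_surj_bij => [a b ab|n].
  apply/eqP; rewrite -subr_eq0; apply: contraT => ab0.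
  have := invertible_torsion_free MN dom m0 ab0.
  by rewrite ractDr (morphDN (ractDr m)) ab subrr eqxx.
move: n; apply: (@invertible_simple A M N MN (fun n => exists a, ract m a = n) m).
- exact: qtorus_simple hq.
- move=> n n' [a <-] [b <-]; exists (a - b); apply: (addIr (ract m b)).
  by rewrite -ractDr !subrK.
- by move=> a n [b <-]; exists (theta pq w a * b); rewrite ractM -tm lractA.
- by move=> a n [b <-]; exists (b * a); rewrite ractM.
- by exists 1; rewrite ract1.
- exact: m0.
Qed.

End InvertibleQuantumTorus.

(** * The kernel of [Omega] *)

Section Kernel.
Variables (F : fieldType) (q p : Fstar F).
Notation Q := (fs_val q).
Notation A := (qtorus q).
Hypothesis hq : forall n : nat, (0 < n)%N -> Q ^+ n != 1.
Hypothesis pq : fs_val p ^+ 2 = Q.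

Let Z_mon (w v : int * int) : mon q w * mon q v =
  (Q ^ (w.1 * v.2 - v.1 * w.2) *: mon q v) * mon q w.
Proof. by rewrite mon_conj scalerAl. Qed.

Lemma qx_mon : qx q = mon q (1, 0). Proof. by rewrite /mon /= mul1r. Qed.
Lemma qy_mon : qy q = mon q (0, 1). Proof. by rewrite /mon /= mulr1. Qed.

Lemma mon_qx v : mon q v * qx q = (Q ^ (- v.2) *: qx q) * mon q v.
Proof. by rewrite qx_mon Z_mon /= mulr0 sub0r mul1r. Qed.
Lemma mon_qy v : mon q v * qy q = (Q ^ v.1 *: qy q) * mon q v.
Proof. by rewrite qy_mon Z_mon /= mulr1 mul0r subr0. Qed.

Lemma mon_mulIf v : injective (fun a : A => a * mon q v).
Proof.
move=> a b /= ab; rewrite -[a]mulr1 -[b]mulr1 -(mon_invr q v).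
by rewrite (mulrA a) (mulrA b) ab.
Qed.

(* A bimodule isomorphism A^s -> A is left multiplication by a unit c with    *)
(* c b = s(b) c, and the units are the scalar multiples of monomials. *)
Lemma Omega_eq1 (s : algAut A) : Omega s = pic_one A <->
  exists v, s (qx q) = Q ^ (- v.2) *: qx q /\ s (qy q) = Q ^ v.1 *: qy q.
Proof.
split=> [/pic_classP [f [[fD fl fr] [g fK gK]]]|[v [sx sy]]].
  have fE (a : A) : f a = (f 1 : A) * a by rewrite -[RHS]fr [ract _ a]mul1r.
  have [|v [k k0 f1]] := @qtorus_unit F q (f 1) (g 1); first by rewrite -fE gK.
  have fs b : (f 1 : A) * b = s b * (f 1 : A).
    by rewrite -[RHS]fl /= /twisted_lact autK [b * 1]mulr1 -fE.
  exists v; split; apply: (@mon_mulIf v); apply: (scalerI k0).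
    by rewrite -mon_qx scalerAr -f1 -fs f1 -scalerAl.
  by rewrite -mon_qy scalerAr -f1 -fs f1 -scalerAl.
have [c [c' [cc' c'c cx cy]]] : exists c c' : A, [/\ c * c' = 1, c' * c = 1,
    c * qx q = s (qx q) * c & c * qy q = s (qy q) * c].
  exists (mon q v), (Q ^ (v.1 * v.2) *: mon q (- v)).
  by rewrite mon_invr mon_invl sx sy mon_qx mon_qy.
have sc b : c * b = s b * c.
  have e : (fun b => c * b * c') =1 s.
    apply: qtorus_hom_ext; try exact: aut_linear; try exact: aut_monoid.
    - by move=> k a b' /=; rewrite mulrDr mulrDl -(scalerAr k) -(scalerAl k).
    - split=> [|a b'] /=; first by rewrite mulr1.
      by rewrite -!mulrA (mulrA c' c) c'c mul1r.
    - by rewrite cx -mulrA cc' mulr1.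
    - by rewrite cy -mulrA cc' mulr1.
  by rewrite -e /= -(mulrA (c * b)) c'c mulr1.
apply/pic_classP; exists (fun a : A => c * a); split.
  split=> [a b|a b|a b]; first exact: mulrDr.
    by rewrite /= /twisted_lact mulrA sc autVK -mulrA.
  exact: mulrA.
by exists (fun a : A => c' * a) => a; rewrite mulrA ?cc' ?c'c mul1r.
Qed.

Lemma Omega_theta_eq1 w : Omega (theta pq w) = pic_one A <-> mod_q q w = 1%g.
Proof.
have [_ _ tor _ _ _] := theta_identification pq hq.
split=> [/Omega_eq1 [v [sx sy]]|].
  have -> : w = torus_elt (expgz q (- v.2)) (expgz q v.1).
    apply: (@theta_inj F q p pq); apply: algAut_inj.
    have [tx ty] := tor (expgz q (- v.2)) (expgz q v.1).
    apply: qtorus_hom_ext; try exact: aut_linear; try exact: aut_monoid.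
      by rewrite tx expgz_val.
    by rewrite ty expgz_val.
  congr Semidirect; congr (_, _); apply/fsq_piP.
    by exists (- v.2); rewrite mulg1.
  by exists v.1; rewrite mulg1.
case: w => [[t1 t2] g] h.
have /fsq_piP [n e1] := congr1 (fun W => (sd_n W).1) h.
have /fsq_piP [m e2] := congr1 (fun W => (sd_n W).2) h.
have /= g1 := congr1 (@sd_h _ _ _) h.
(* By [Omega_eq1] the exponent v must satisfy t1 = q^(-v.2) and t2 = q^(v.1), while here t1 = q^n
   and t2 = q^m. *)
apply/Omega_eq1; exists (m, - n).
have [tx ty] := tor t1 t2; rewrite /torus_elt in tx ty.
rewrite /= in e1 e2; rewrite g1 tx ty e1 e2 !mulg1 !expgz_val opprK.
by [].
Qed.

Lemma lg_mulI (G : largeGroup) (x y z : G) : lg_mul x y = lg_mul x z -> y = z.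
Proof.
move/(congr1 (lg_mul (lg_inv x))).
by rewrite !lg_mulA !lg_mulV !lg_mul1.
Qed.

Lemma Omega_theta_eq w w' :
  Omega (theta pq w) = Omega (theta pq w') <-> mod_q q w = mod_q q w'.
Proof.
have e : w' = (w * (w^-1 * w'))%g by rewrite mulgA mulgV mul1g.
have Om u : Omega (theta pq (w * u)%g) =
    lg_mul (Omega (theta pq w)) (Omega (theta pq u)).
  by rewrite thetaM OmegaM.
have O1 x : lg_mul x (pic_one A : Pic A) = x := lg_mulr1 x.
split=> h.
  rewrite e mod_qM (_ : mod_q q (w^-1 * w')%g = 1%g) ?mulg1 //.
  apply/Omega_theta_eq1; apply: (@lg_mulI (Pic A) (Omega (theta pq w))).
  by rewrite -Om -e O1.
rewrite e Om (_ : Omega (theta pq (w^-1 * w')%g) = pic_one A) ?O1 //.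
apply/Omega_theta_eq1; apply: (@mulgI _ (mod_q q w)).
by rewrite mulg1 -mod_qM -e.
Qed.

Lemma mod_q_surj (W : torus_modQ_SL2Z q) : exists w, mod_q q w = W.
Proof.
case: W => [[a b] g]; exists (Semidirect _ (rep a, rep b) g).
by congr Semidirect; congr (_, _); exact: fsq_pi_rep.
Qed.

End Kernel.

Theorem theorem3 (R : realType) (q : Fstar (complex R))
    (hq : forall n : nat, (0 < n)%N -> fs_val q ^+ n != 1) :
  exists theta : torus_SL2Z (complex R) -> algAut (qtorus q),
    is_identification theta /\
    exists Phi : torus_modQ_SL2Z q -> Pic (qtorus q),
      [/\ bijective Phi,
          forall u v, Phi (u * v)%g = lg_mul (Phi u) (Phi v)
        & forall w, Phi (mod_q q w) = Omega (theta w)].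
Proof.
have p0 : sqrtC (fs_val q) != 0 by rewrite sqrtC_eq0 fs_neq0.
have pq : fs_val (FStar p0) ^+ 2 = fs_val q := sqrtCK _.
exists (theta pq); split; first exact: theta_identification.
(* An arbitrary choice of preimages; [PhiE] makes the value of [Omega] independent of it. *)
pose lift W := sval (cid (@mod_q_surj _ q W)).
have liftK W : mod_q q (lift W) = W by rewrite /lift; case: cid.
have PhiE w : Omega (theta pq (lift (mod_q q w))) = Omega (theta pq w).
  by apply/Omega_theta_eq => //; rewrite liftK.
exists (fun W => Omega (theta pq (lift W))); split=> //.
- apply: inj_surj_bij => [V W VW|c].
    by rewrite -[V]liftK -[W]liftK; apply/(Omega_theta_eq hq pq).
  elim/pic_ind: c => M iM sM.
  have [w wM] := invertible_twisted hq iM sM pq.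
  by exists (mod_q q w); rewrite PhiE; apply/pic_classP.
- move=> U V; rewrite -OmegaM -thetaM; apply/(Omega_theta_eq hq pq).
  by rewrite mod_qM !liftK.
Qed.
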